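(* Let $(R,\mathfrak m,k)$ be a Noetherian local ring which is a homomorphic image of a Cohen–Macaulay local ring, and let $M$ be a finitely generated $R$-module of dimension $d>0$. If $\underline{x}=x_1,\dots,x_d$ and $\underline{y}=y_1,\dots,y_d$ are two $C$-systems of parameters of $M$, then $\mathrm{ir}_M(\underline{x})=\mathrm{ir}_M(\underline{y})$. That is, the index of reducibility $\mathrm{ir}_M(\underline{x})$ of the ideal $(\underline{x})$ on $M$ does not depend on the choice of the $C$-system of parameters $\underline{x}$.
   Context: For a finitely generated $R$-module $N$ and an ideal $\mathfrak q$ generated by a system of parameters of $N$, the index of reducibility $\mathrm{ir}_N(\mathfrak q)$ is the number of irreducible components in an irredundant irreducible decomposition of the submodule $\mathfrak qN$ of $N$; equivalently $\mathrm{ir}_N(\mathfrak q)=\dim_k \mathrm{Soc}(N/\mathfrak q N)$, where $\mathrm{Soc}(L)=0:_L\mathfrak m$. For a system of parameters $\underline{x}$ we write $\mathrm{ir}_N(\underline{x})=\mathrm{ir}_N((\underline{x}))$. For a finitely generated $R$-module $N$ of dimension $s>0$, define $\mathfrak b(N)=\bigcap \mathrm{Ann}_R\big(0:_{N/(z_1,\dots,z_{i-1})N} z_i\big)$, the intersection taken over all systems of parameters $z_1,\dots,z_s$ of $N$ and all $i=1,\dots,s$. A system of parameters $x_1,\dots,x_d$ of $M$ is a $C$-system of parameters of $M$ if $x_d\in\mathfrak b(M)^3$ and $x_i\in\mathfrak b(M/(x_{i+1},\dots,x_d)M)^3$ for all $i=d-1,\dots,1$. *)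

(* Defs.v *)
From HB Require Import structures.
From mathcomp Require Import all_boot all_order all_algebra.
Set Implicit Arguments. Unset Strict Implicit. Unset Printing Implicit Defensive.
Import GRing.Theory.
Local Open Scope ring_scope.

Section CommAlg.
Variable R : comNzRingType.

Definition ideal (I : R -> Prop) : Prop :=
  [/\ I 0, (forall a b, I a -> I b -> I (a + b)) & (forall r a, I a -> I (r * a))].

Definition subI (I J : R -> Prop) : Prop := forall r, I r -> J r.
Definition strictI (I J : R -> Prop) : Prop := subI I J /\ exists r, J r /\ ~ I r.

Definition prime_ideal (P : R -> Prop) : Prop :=
  [/\ ideal P, ~ P 1 & (forall a b, P (a * b) -> P a \/ P b)].

Definition maximal_ideal (I : R -> Prop) : Prop :=
  [/\ ideal I, ~ I 1 & (forall J, ideal J -> ~ J 1 -> subI I J -> subI J I)].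

Definition local_ring (m : R -> Prop) : Prop :=
  maximal_ideal m /\ (forall I, maximal_ideal I -> forall r, I r <-> m r).

Definition noetherian : Prop :=
  forall I : nat -> R -> Prop, (forall n, ideal (I n)) ->
    (forall n, subI (I n) (I n.+1)) ->
    exists n0, forall n, (n0 <= n)%N -> forall r, I n r <-> I n0 r.

Definition gen_ideal (S : R -> Prop) : R -> Prop :=
  fun r => forall J, ideal J -> subI S J -> J r.

Definition ideal_cube (I : R -> Prop) : R -> Prop :=
  gen_ideal (fun x => exists a b c, [/\ I a, I b, I c & x = a * b * c]).

Definition prime_chain (A : R -> Prop) (n : nat) : Prop :=
  exists p : nat -> R -> Prop,
    [/\ forall i, (i <= n)%N -> prime_ideal (p i),
        subI A (p 0%N) &
        forall i, (i < n)%N -> strictI (p i) (p i.+1)].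

Definition chain_dim (A : R -> Prop) (d : nat) : Prop :=
  prime_chain A d /\ ~ prime_chain A d.+1.

Definition ring_dim (d : nat) : Prop := chain_dim (fun _ => False) d.

(* ---------- modules: M/K is represented by a submodule K of M ---------- *)
Variable M : lmodType R.

Definition submodule (N : M -> Prop) : Prop :=
  [/\ N 0, (forall u v, N u -> N v -> N (u + v)) & (forall r v, N v -> N (r *: v))].

Definition subM (N P : M -> Prop) : Prop := forall v, N v -> P v.
Definition strictM (N P : M -> Prop) : Prop := subM N P /\ exists v, P v /\ ~ N v.

Definition zero_sub : M -> Prop := fun v => v = 0.

Definition sub_gen (K : M -> Prop) (z : seq R) : M -> Prop :=
  fun v => forall N, submodule N -> subM K N ->
    (forall j w, (j < size z)%N -> N (z`_j *: w)) -> N v.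

Definition fin_gen : Prop :=
  exists s : seq M, forall v, exists c : 'I_(size s) -> R,
    v = \sum_(i < size s) c i *: s`_i.

Definition ann_quot (K : M -> Prop) : R -> Prop := fun r => forall v, K (r *: v).

Definition module_dim (K : M -> Prop) (d : nat) : Prop := chain_dim (ann_quot K) d.

Definition finite_length (K : M -> Prop) : Prop :=
  exists L : nat, forall (k : nat) (N : nat -> M -> Prop),
    (forall i, (i <= k)%N -> submodule (N i) /\ subM K (N i)) ->
    (forall i, (i < k)%N -> strictM (N i) (N i.+1)) -> (k <= L)%N.

Variable m : R -> Prop.

Definition sop (K : M -> Prop) (z : seq R) : Prop :=
  [/\ module_dim K (size z), (forall j, (j < size z)%N -> m z`_j)
    & finite_length (sub_gen K z)].

(* b(M/K) : intersection over all s.o.p. z of M/K and all i of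
   Ann( 0 :_{(M/K)/(z_1..z_{i-1})(M/K)} z_i )   (0-based index i here) *)
Definition bideal (K : M -> Prop) : R -> Prop :=
  fun r => forall z, sop K z -> forall i, (i < size z)%N ->
    forall v, sub_gen K (take i z) (z`_i *: v) -> sub_gen K (take i z) (r *: v).

(* C-system of parameters of M (0-based: x`_j in b(M/(x_{j+1},...,x_{d-1})M)^3) *)
Definition c_sop (x : seq R) : Prop :=
  sop zero_sub x /\
  forall j, (j < size x)%N -> ideal_cube (bideal (sub_gen zero_sub (drop j.+1 x))) x`_j.

(* dim_k Soc(M/Q) = n, where k = R/m; a k-basis is given by representatives *)
Definition socle (Q : M -> Prop) : M -> Prop :=
  fun v => forall r, m r -> Q (r *: v).

Definition socle_kdim (Q : M -> Prop) (n : nat) : Prop :=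
  exists v : 'I_n -> M,
    [/\ forall i, socle Q (v i),
        (forall w, socle Q w -> exists c : 'I_n -> R,
            Q (w - \sum_(i < n) c i *: v i)) &
        (forall c : 'I_n -> R, Q (\sum_(i < n) c i *: v i) -> forall i, m (c i))].

Definition ir_is (x : seq R) (n : nat) : Prop := socle_kdim (sub_gen zero_sub x) n.

End CommAlg.

(* Cohen-Macaulay local ring: Noetherian local with depth = dim, i.e. an
   S-regular sequence in mS of length dim S exists *)
Definition regular_seq (S : comNzRingType) (mS : S -> Prop) (z : seq S) : Prop :=
  (forall j, (j < size z)%N -> mS z`_j) /\
  ~ gen_ideal (fun r => exists j, (j < size z)%N /\ r = z`_j) 1 /\
  forall i, (i < size z)%N -> forall a,
    gen_ideal (fun r => exists j, (j < i)%N /\ r = z`_j) (z`_i * a) ->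
    gen_ideal (fun r => exists j, (j < i)%N /\ r = z`_j) a.

Definition cohen_macaulay_local (S : comNzRingType) (mS : S -> Prop) : Prop :=
  [/\ noetherian S, local_ring mS &
      exists d, ring_dim S d /\ exists z : seq S, size z = d /\ regular_seq mS z].

Definition cm_image (R : comNzRingType) : Prop :=
  exists (S : comNzRingType) (mS : S -> Prop) (f : {rmorphism S -> R}),
    cohen_macaulay_local mS /\ forall r : R, exists s, f s = r.

(* Main.v *)
(* Write [b_i] for the ideal [bideal] of [M / (x_(i+1), ..., x_(d-1)) M].

   If [K] is a submodule of [M], [B] an ideal, and [a] is an element of [m B] such that
   [B] annihilates the elements of [M / K] killed by [a ^+ 2], then
   [H := {v | B v <= K}] gives an exact sequence
     [0 -> Soc (H / K) -> Soc (M / (K + a M)) -> Soc (M / (H + a M)) -> 0],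
   and the dimension of the last term does not depend on [a] because [a] is a
   nonzerodivisor on [M / H].  Applied to [B := b_i], this shows that in a system of
   parameters [z_0, ..., z_(i-1), x_i, ..., x_(d-1)] the element [x_i] of [m b_i] can be
   exchanged for any other parameter in [m b_i], whatever [z_0, ..., z_(i-1)] are.

   Since [b_j] contains the annihilator of [M / (x_(j+1), ..., x_(d-1)) M] and [x_j],
   the ring [R / b_j] has dimension at most [j].  Prime avoidance therefore gives
   [z_0, ..., z_(d-1)], with [z_i] in [m b_i] for both given C-systems of parameters,
   such that every [R / (b_j + (z_0, ..., z_(i-1)))] with [i <= j] has dimension at most
   [j - i] and all the exchanges are between systems of parameters.  Exchanging from
   left to right transforms both C-systems of parameters into [z]. *)
From Stdlib Require Import Classical ClassicalEpsilon.
From Stdlib Require List.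
Require Import Defs.
From mathcomp Require Import all_boot all_algebra.
From mathcomp Require Import ring.
Set Implicit Arguments. Unset Strict Implicit. Unset Printing Implicit Defensive.
Import GRing.Theory.
Local Open Scope ring_scope.

(** * Submodules and Noetherian induction *)

Section Submodules.
Variables (R : comNzRingType) (M : lmodType R).
Implicit Types (N K L : M -> Prop) (u v w : M) (r s t a b c : R).

Lemma submB N u v : submodule N -> N u -> N v -> N (u - v).
Proof. by move=> [_ NA NZ] Nu Nv; rewrite -scaleN1r; apply: NA => //; apply: NZ. Qed.

Lemma submDr N u v : submodule N -> N u -> N (u + v) -> N v.
Proof. by move=> sN Nu /(submB sN)/(_ Nu); rewrite addrC addKr. Qed.

Lemma submDl N u v : submodule N -> N v -> N (u + v) -> N u.
Proof. by rewrite addrC; apply: submDr. Qed.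

Lemma subm_sum N n (F : 'I_n -> M) :
  submodule N -> (forall i, N (F i)) -> N (\sum_i F i).
Proof. by move=> [N0 NA _] NF; apply: big_ind. Qed.

Lemma zero_submodule : submodule (@zero_sub R M).
Proof.
rewrite /zero_sub; split=> [//|u v -> ->|r v ->]; [exact: addr0 | exact: scaler0].
Qed.

Definition adjoin N v : M -> Prop := fun w => exists n t, N n /\ w = n + t *: v.

Lemma adjoin_submodule N v : submodule N -> submodule (adjoin N v).
Proof.
move=> [N0 NA NZ]; split=> [|_ _ [n [t [Nn ->]]] [n' [t' [Nn' ->]]]|r _ [n [t [Nn ->]]]].
- by exists 0, 0; rewrite scale0r addr0.
- by exists (n + n'), (t + t'); rewrite scalerDl addrACA; split=> //; apply: NA.
- by exists (r *: n), (r * t); rewrite scalerDr scalerA; split=> //; apply: NZ.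
Qed.

Lemma adjoin_sub N v : subM N (adjoin N v).
Proof. by move=> n Nn; exists n, 0; rewrite scale0r addr0. Qed.

Lemma adjoin_id N v : submodule N -> adjoin N v v.
Proof. by move=> [N0 _ _]; exists 0, 1; rewrite scale1r add0r. Qed.

Lemma adjoin_min N L v : submodule L -> subM N L -> L v -> subM (adjoin N v) L.
Proof. by move=> [_ LA LZ] NL Lv _ [n [t [/NL Ln ->]]]; apply: LA => //; apply: LZ. Qed.

Lemma adjoin_strict N v : submodule N -> ~ N v -> strictM N (adjoin N v).
Proof. by move=> sN Nv; split; [exact: adjoin_sub | exists v; split=> //; apply: adjoin_id]. Qed.

Definition add_smul N a : M -> Prop := fun w => exists n v, N n /\ w = n + a *: v.

Lemma add_smul_submodule N a : submodule N -> submodule (add_smul N a).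
Proof.
move=> [N0 NA NZ]; split=> [|_ _ [n [v [Nn ->]]] [n' [v' [Nn' ->]]]|r _ [n [v [Nn ->]]]].
- by exists 0, 0; rewrite scaler0 addr0.
- by exists (n + n'), (v + v'); rewrite scalerDr addrACA; split=> //; apply: NA.
- exists (r *: n), (r *: v); rewrite scalerDr !scalerA [a * r]mulrC.
  by split=> //; apply: NZ.
Qed.

Lemma add_smul_sub N a : subM N (add_smul N a).
Proof. by move=> n Nn; exists n, 0; rewrite scaler0 addr0. Qed.

Lemma add_smul_smul N a v : submodule N -> add_smul N a (a *: v).
Proof. by move=> [N0 _ _]; exists 0, v; rewrite add0r. Qed.

Lemma colon_ideal K v : submodule K -> ideal (fun r => K (r *: v)).
Proof.
move=> [K0 KA KZ]; split=> [|a b Ka Kb|r a Ka]; first by rewrite scale0r.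
  by rewrite scalerDl; apply: KA.
by rewrite -scalerA; apply: KZ.
Qed.

Definition acc_submodules : Prop := forall N : nat -> M -> Prop,
  (forall n, submodule (N n)) -> (forall n, subM (N n) (N n.+1)) ->
  exists n0, forall n, (n0 <= n)%N -> subM (N n) (N n0).

(** A counterexample would, by choice, start an infinite strictly ascending chain of
    counterexamples. *)
Lemma noeth_ind (P : (M -> Prop) -> Prop) : acc_submodules ->
  (forall N, submodule N ->
     (forall N', submodule N' -> strictM N N' -> P N') -> P N) ->
  forall N, submodule N -> P N.
Proof.
move=> acc step N0 sN0; apply: NNPP => nP0.
pose bad := {N | submodule N /\ ~ P N}.
have next (N : bad) : {N' : bad | strictM (sval N) (sval N')}.
  apply: constructive_indefinite_description; case: N => N [sN nPN] /=.
  apply: NNPP => no; apply: nPN; apply: step => // N' sN' NN'; apply: NNPP => nPN'.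
  by apply: no; exists (exist _ N' (conj sN' nPN')).
pose f n := iter n (fun B => sval (next B)) (exist _ N0 (conj sN0 nP0) : bad).
have fS n : strictM (sval (f n)) (sval (f n.+1)) by exact: (svalP (next (f n))).
have [n|n|n0 /(_ n0.+1 (leqnSn _)) stop] := acc (fun n => sval (f n)).
- by case: (svalP (f n)).
- by case: (fS n).
- by case: (fS n0) => _ [v [/stop]].
Qed.

End Submodules.

(** * The ascending chain condition for finitely generated modules *)

Section Noetherian.
Variables (R : comNzRingType).

Lemma chain_mono (T : Type) (N : nat -> T -> Prop) (i j : nat) :
  (forall n v, N n v -> N n.+1 v) -> (i <= j)%N -> forall v, N i v -> N j v.
Proof.
move=> NS /subnK <-; elim: (j - i)%N => [//|k IH] v /IH; rewrite addSn; exact: NS.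
Qed.

Lemma acc_regular : noetherian R -> @acc_submodules R R^o.
Proof.
move=> noeR N sN NS; have [n0 Hn0] := noeR N sN NS.
by exists n0 => n /Hn0 H v; case: (H v).
Qed.

Lemma acc_fin_gen (M : lmodType R) :
  noetherian R -> fin_gen M -> acc_submodules M.
Proof.
move=> noeR [s gen] N sN NS.
have mono i j := @chain_mono _ N i j NS.
pose S k v := exists c : nat -> R, v = \sum_(i < k) c i *: s`_i.
have SB k u v : S k u -> S k v -> S k (u - v).
  move=> [c ->] [c' ->]; exists (fun i => c i - c' i); rewrite -sumrB.
  by apply: eq_bigr => i _; rewrite scalerBl.
(* By induction on [k], the parts of the [N n] in the span of the first [k] generators become
   stationary. In the step, [I n] is the ideal of the possible coefficients of the next
   generator. *)
have stat k : exists n0, forall n, (n0 <= n)%N -> forall v, S k v -> N n v -> N n0 v.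
  elim: k => [|k [n0 IH]].
    exists 0%N => n _ v [c ->] _; rewrite big_ord0; by case: (sN 0%N).
  pose I n (t : R) := exists w, S k w /\ N n (w + t *: s`_k).
  have [n|n t [w [Sw Nw]]|n1 Hn1] := noeR I.
  - have [N0 NA NZ] := sN n; split=> [|a b [w [[c ->] Nw]] [w' [[c' ->] Nw']]|r a [w [[c ->] Nw]]].
    + exists 0; split; last by rewrite scale0r addr0.
      by exists (fun=> 0); rewrite big1 // => i _; rewrite scale0r.
    + exists (\sum_(i < k) c i *: s`_i + \sum_(i < k) c' i *: s`_i); split.
        exists (fun i => c i + c' i); rewrite -big_split.
        by apply: eq_bigr => i _; rewrite /= scalerDl.
      by rewrite scalerDl addrACA; apply: NA.
    + exists (r *: \sum_(i < k) c i *: s`_i); split.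
        exists (fun i => r * c i); rewrite scaler_sumr.
        by apply: eq_bigr => i _; rewrite scalerA.
      by rewrite -scalerA -scalerDr; apply: NZ.
  - by exists w; split=> //; apply: NS.
  exists (maxn n0 n1) => n; rewrite geq_max => /andP[le0 le1] _ [c ->].
  rewrite big_ord_recr /=; set w := \sum_(i < k) _; set t := c k => Nv.
  have Sw : S k w by exists c.
  have : I n1 t by apply/(Hn1 n le1); exists w.
  move=> [w' [Sw' Nw']].
  (* Elements with the same last coefficient differ by an element of the span [S k]. *)
  have Nww' : N n (w - w').
    have -> : w - w' = w + t *: s`_k - (w' + t *: s`_k).
      by rewrite opprD addrACA subrr addr0.
    by apply: submB => //; apply: mono Nw'.
  have Nmax := mono _ _ (leq_maxl n0 n1) _ (IH n le0 _ (SB _ _ _ Sw Sw') Nww').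
  have -> : w + t *: s`_k = w - w' + (w' + t *: s`_k) by rewrite addrA subrK.
  by have [_ NA _] := sN (maxn n0 n1); apply: NA => //; apply: mono Nw'; apply: leq_maxr.
have [n0 Hn0] := stat (size s); exists n0 => n le v; apply: Hn0 => //.
have [c ->] := gen v.
exists (fun i => if insub i is Some j then c j else 0); apply: eq_bigr => i _.
by rewrite valK.
Qed.

End Noetherian.

(** * Localization at a prime by means of saturated submodules *)

Section Local.
Variables (R : comNzRingType) (M : lmodType R).
Implicit Types (N K L : M -> Prop) (p q r P : R -> Prop).

Lemma prime_mul_notin P a b : prime_ideal P -> ~ P a -> ~ P b -> ~ P (a * b).
Proof. by move=> [_ _ pr] Pa Pb /pr[]. Qed.

Lemma prime_X P a n : prime_ideal P -> P (a ^+ n) -> P a.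
Proof.
move=> [_ P1 pr]; elim: n => [|n IH]; first by rewrite expr0 => /P1.
by rewrite exprS => /pr[].
Qed.

Lemma idealN P a : ideal P -> P a -> P (- a).
Proof. by move=> [_ _ PM] /(PM (-1)); rewrite mulN1r. Qed.

Lemma idealB P a b : ideal P -> P a -> P b -> P (a - b).
Proof. by move=> iP Pa /(idealN iP) Pb; case: (iP) => _ PA _; apply: PA. Qed.

Lemma idealDr P a b : ideal P -> P a -> P (a + b) -> P b.
Proof. by move=> iP Pa /(idealB iP)/(_ Pa); rewrite addrC addKr. Qed.

Lemma gen_ideal_ideal (A : R -> Prop) : ideal (gen_ideal A).
Proof.
split=> [J [J0 _ _] _|a b Aa Ab J iJ AJ|r a Aa J iJ AJ] //.
  by have [_ JA _] := iJ; apply: JA; [apply: Aa | apply: Ab].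
by have [_ _ JZ] := iJ; apply: JZ; apply: Aa.
Qed.

(* The submodules that are contracted from the localization at [r]. *)
Definition sat r N : M -> Prop := fun v => exists s, ~ r s /\ N (s *: v).
Definition saturated r N : Prop := forall s v, ~ r s -> N (s *: v) -> N v.

Lemma sat_submodule r N : prime_ideal r -> submodule N -> submodule (sat r N).
Proof.
move=> pr [N0 NA NZ]; have [_ r1 _] := pr.
split=> [|u v [s [rs Nu]] [t [rt Nv]]|a v [s [rs Nv]]].
- by exists 1; rewrite scaler0.
- exists (s * t); split; first exact: prime_mul_notin.
  rewrite scalerDr; apply: NA; last by rewrite -scalerA; apply: NZ.
  by rewrite mulrC -scalerA; apply: NZ.
- by exists s; split=> //; rewrite scalerA mulrC -scalerA; apply: NZ.
Qed.

Lemma sat_sub r N : prime_ideal r -> subM N (sat r N).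
Proof. by move=> [_ r1 _] v Nv; exists 1; rewrite scale1r. Qed.

Lemma sat_saturated r N : prime_ideal r -> saturated r (sat r N).
Proof.
move=> pr s v rs [t [rt Nv]]; exists (t * s); split; first exact: prime_mul_notin.
by rewrite -scalerA.
Qed.

Lemma sat_min r N L : saturated r L -> subM N L -> subM (sat r N) L.
Proof. by move=> satL NL v [s [rs /NL]]; apply: satL. Qed.

(** A maximal annihilator of a nonzero element of [M / K] is prime: when [a * b] kills [v] but
    neither factor does, the annihilator of [b *: v] is strictly larger. *)
Lemma assoc_prime K : noetherian R -> submodule K -> (exists v, ~ K v) ->
  exists v, ~ K v /\ prime_ideal (fun a => K (a *: v)).
Proof.
move=> noeR sK [v0 Kv0].
pose good (I : R^o -> Prop) := (exists v, ~ K v /\ forall a, K (a *: v) <-> I a) ->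
  exists v, ~ K v /\ prime_ideal (fun a => K (a *: v)).
apply: (@noeth_ind _ _ good (acc_regular noeR) _ _ (colon_ideal v0 sK)); last first.
  by exists v0.
move=> I sI IH [v [Kv vI]].
have [pr|npr] := classic (prime_ideal (fun a => K (a *: v))); first by exists v.
have [a [b [Kab [Ka Kb]]]] : exists a b, K ((a * b) *: v) /\ ~ K (a *: v) /\ ~ K (b *: v).
  apply: NNPP => no; apply: npr; split; [exact: colon_ideal | by rewrite scale1r|].
  move=> a b Kab; apply: NNPP => nab; apply: no; exists a, b; split=> //.
  by split=> h; apply: nab; [left | right].
apply: (IH _ (colon_ideal (b *: v) sK)); last by exists (b *: v).
split=> [c /vI Kc|].
  by rewrite scalerA mulrC -scalerA; case: sK => _ _; apply.
by exists a; split; [rewrite scalerA | move/vI].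
Qed.

(* Nakayama's lemma for the localization at [r] of the module [(K + N) / K]. *)
Lemma nakayama r K N : acc_submodules M -> prime_ideal r -> submodule K ->
  (forall L, submodule L -> subM K L -> (forall a v, r a -> N v -> L (a *: v)) ->
     forall v, N v -> exists s, ~ r s /\ L (s *: v)) ->
  subM N (sat r K).
Proof.
move=> acc pr sK hyp; have [[_ rA rM] _ _] := pr.
suff gen L : submodule L -> saturated r L /\ subM K L -> subM N L.
  apply: gen; first exact: sat_submodule.
  by split; [exact: sat_saturated | exact: sat_sub].
move: L; apply: noeth_ind => // L sL IH [satL KL].
(* If [r N] is not inside [L], induction on [L] enlarged by a missing [a *: v] gives
   [s *: v = n + t *: (a *: v)], and [s - t * a] is outside [r]. *)
have [[a [v [ra [Nv Lav]]]]|closed] :=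
    classic (exists a v, r a /\ N v /\ ~ L (a *: v)).
  case: (Lav); have sLav := adjoin_submodule (a *: v) sL.
  have NL' : subM N (sat r (adjoin L (a *: v))).
    apply: IH; first exact: sat_submodule.
      split; first by move=> w Lw; apply: sat_sub => //; apply: adjoin_sub.
      by exists (a *: v); split=> //; apply: sat_sub => //; apply: adjoin_id.
    split; first exact: sat_saturated.
    by move=> w /KL Lw; apply: sat_sub => //; apply: adjoin_sub.
  have [s [rs [n [t [Ln e]]]]] := NL' v Nv.
  have Lv : L v.
    apply: (satL (s - t * a)) => [rsta|].
      by apply: rs; rewrite -(subrK (t * a) s); apply: rA => //; apply: rM.
    by rewrite scalerBl e scalerA addrK.
  by case: sL => _ _; apply.
move=> v /(hyp L sL KL) [a w ra Nw|s [rs Lsv]]; last exact: satL Lsv.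
by apply: NNPP => Law; apply: closed; exists a, w.
Qed.

(** For a saturated [K] this bounds the length of the localization of [M / K] at [r], whose
    submodules correspond to the saturated submodules containing [K]. *)
Definition bounded_chains r K (b : nat) : Prop :=
  forall (k : nat) (N : nat -> M -> Prop),
    (forall i, (i <= k)%N -> [/\ submodule (N i), saturated r (N i) & subM K (N i)]) ->
    (forall i, (i < k)%N -> strictM (N i) (N i.+1)) -> (k <= b)%N.

(** The class of [v] generates a simple submodule of the localization of [M / K], and dividing by it
    shortens a chain by at most one step. *)
Lemma bounded_chains_adjoin r K v b : prime_ideal r -> submodule K -> saturated r K ->
  ~ K v -> (forall a, r a -> K (a *: v)) ->
  bounded_chains r (sat r (adjoin K v)) b -> bounded_chains r K b.+1.
Proof.
move=> pr sK satK Kv rv bnd [//|k] N HN ltN; rewrite ltnS.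
(* Adding [v] to the members of the chain keeps the inclusions strict except possibly where [v]
   enters; that step is skipped by shifting the index from there on. *)
pose G i w := N i v /\ N i.+1 w \/ ~ N i v /\ sat r (adjoin (N i) v) w.
have Gin i w : N i v -> G i w <-> N i.+1 w.
  by move=> Niv; split=> [[[]|[]]|]//; left.
have Gout i w : ~ N i v -> G i w <-> sat r (adjoin (N i) v) w.
  by move=> Niv; split=> [[[]|[]]|]//; right.
have ext (P Q : M -> Prop) : (forall w, P w <-> Q w) ->
    [/\ submodule Q, saturated r Q & subM (sat r (adjoin K v)) Q] ->
    [/\ submodule P, saturated r P & subM (sat r (adjoin K v)) P].
  move=> PQ [[Q0 QA QZ] satQ KQ]; split; last by move=> w /KQ /PQ.
    split=> [|a c /PQ Qa /PQ Qc|a c /PQ Qc]; apply/PQ => //; first exact: QA.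
    exact: QZ.
  by move=> s w rs /PQ /(satQ _ _ rs) /PQ.
apply: (bnd k G) => i ltik.
  have [sN satN KN] := HN i (leqW ltik).
  have [sN' satN' KN'] := HN i.+1 ltik.
  have [Niv|Niv] := classic (N i v).
    apply: ext (Gin i ^~ Niv) _; split=> //.
    apply: sat_min => //; apply: adjoin_min => //.
    by case: (ltN i ltik) => + _; apply.
  apply: ext (Gout i ^~ Niv) _; split; last 1 first.
  - apply: sat_min; first exact: sat_saturated.
    move=> w [n [t [Kn ->]]]; apply: sat_sub => //.
    by exists n, t; split=> //; apply: KN.
  - by apply: sat_submodule => //; apply: adjoin_submodule.
  - exact: sat_saturated.
have [sN satN KN] := HN i (leqW (ltnW ltik)).
have [sN' satN' KN'] := HN i.+1 (leqW ltik).
have [lt1 [w1 [Nw1 nNw1]]] := ltN i (leqW ltik).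
have [lt2 [w2 [Nw2 nNw2]]] := ltN i.+1 ltik.
have [Niv|Niv] := classic (N i v).
  have Niv' := lt1 _ Niv; split=> [w /(Gin _ _ Niv) /lt2 Nw|]; first by apply/Gin.
  by exists w2; split; [apply/Gin | move/(Gin _ _ Niv)].
have [Niv'|Niv'] := classic (N i.+1 v).
  have sub : subM (sat r (adjoin (N i) v)) (N i.+1).
    by apply: sat_min => //; apply: adjoin_min.
  split=> [w /(Gout _ _ Niv) /sub /lt2 Nw|]; first by apply/Gin.
  by exists w2; split; [apply/Gin | move/(Gout _ _ Niv)/sub].
split=> [w /(Gout _ _ Niv) [s [rs [n [t [Nn e]]]]]|].
  by apply/Gout => //; exists s; split=> //; exists n, t; split=> //; apply: lt1.
exists w1; split; first by apply/Gout => //; apply: sat_sub => //; apply: adjoin_sub.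
move/(Gout _ _ Niv) => [s [rs [n [t [Nn e]]]]].
have Ntv : N i.+1 (t *: v).
  apply: (submDr sN' (lt1 _ Nn)); rewrite -e; by case: sN' => _ _; apply.
(* Otherwise saturation would put [v] in [N i.+1]. Hence [t *: v] is in [K], which forces [w1] into
   [N i]. *)
have rt : r t by apply: NNPP => rt; apply: Niv'; apply: satN' Ntv.
apply: nNw1; apply: (satN s) => //; rewrite e.
by case: (sN) => _ NA _; apply: NA => //; apply: KN; apply: rv.
Qed.

(** An associated prime of [M / K] contains the annihilator and, as [K] is saturated, lies in [r];
    by minimality it is [r]. Adjoining the corresponding [v] costs one step of length, and
    Noetherian induction on [K] concludes. *)
Lemma finite_length_at r K : acc_submodules M -> noetherian R -> prime_ideal r ->
  submodule K -> saturated r K ->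
  (forall P, prime_ideal P -> subI (ann_quot K) P -> subI P r -> subI r P) ->
  exists b, bounded_chains r K b.
Proof.
move=> acc noeR pr sK.
move: K sK; apply: noeth_ind => // K sK IH satK minr.
have [full|nfull] := classic (forall v, K v).
  exists 0%N => -[//|k] N HN /(_ 0%N isT) [_ [v [_]]].
  by have [_ _ KN] := HN 0%N isT; case; apply: KN.
have [v [Kv prv]] := assoc_prime noeR sK (not_all_ex_not _ _ nfull).
have rv : forall a, r a -> K (a *: v).
  apply: (minr _ prv) => a Kav; first exact: Kav.
  by apply: NNPP => ra; apply: Kv; apply: satK Kav.
have [||||b bnd] := IH (sat r (adjoin K v)).
- by apply: sat_submodule => //; apply: adjoin_submodule.
- split; first by move=> w Kw; apply: sat_sub => //; apply: adjoin_sub.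
  by exists v; split=> //; apply: sat_sub => //; apply: adjoin_id.
- exact: sat_saturated.
- move=> P pP annP; apply: minr => // a Ka; apply: annP => w.
  by apply: sat_sub => //; apply: adjoin_sub.
by exists b.+1; apply: bounded_chains_adjoin bnd.
Qed.

Lemma bounded_chains_dcc r K b (D : nat -> M -> Prop) : bounded_chains r K b ->
  (forall n, [/\ submodule (D n), saturated r (D n) & subM K (D n)]) ->
  (forall n, subM (D n.+1) (D n)) -> exists n, subM (D n) (D n.+1).
Proof.
move=> bnd HD DS; apply: NNPP => no.
have := bnd b.+1 (fun i => D (b.+1 - i)%N) (fun i _ => HD _).
rewrite ltnn => h; apply/notF/h => i; rewrite ltnS => leib.
rewrite subSS subSn //; split; first exact: DS.
apply: NNPP => nv; apply: no; exists (b - i)%N => v Dv.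
by apply: NNPP => nDv; apply: nv; exists v.
Qed.

End Local.


Lemma not_subset (T : Type) (P Q : T -> Prop) :
  ~ (forall a, P a -> Q a) -> exists a, P a /\ ~ Q a.
Proof.
move=> nPQ; apply: NNPP => no; apply: nPQ => a Pa; apply: NNPP => Qa.
by apply: no; exists a.
Qed.

Lemma In_cat (T : Type) (x : T) (s1 s2 : seq T) :
  List.In x (s1 ++ s2) <-> List.In x s1 \/ List.In x s2.
Proof. by elim: s1 => [|y s1 IH] /=; tauto. Qed.

Lemma In_split (T : Type) (x : T) (s : seq T) :
  List.In x s -> exists s1 s2, s = s1 ++ x :: s2.
Proof.
elim: s => [//|y s IH] /= [->|/IH [s1 [s2 ->]]]; first by exists [::], s.
by exists (y :: s1), s2.
Qed.

(** * Krull dimension, minimal primes and prime avoidance *)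

Section Dimension.
Variable R : comNzRingType.
Hypothesis noeR : noetherian R.
Implicit Types (A I J p q r P Q : R -> Prop) (z : seq R).

(* A form of Krull's principal ideal theorem.  If it fails, then [r] is minimal
   over [p + (u)] and [u] is not in [q]; the finite length of the localization at
   [r] makes the [q]-primary components [Q n] of [p + (y ^+ n)] stationary, where
   [y] is in [q] and not in [p]. *)
Lemma prime_between p q r u : prime_ideal p -> prime_ideal q -> prime_ideal r ->
  strictI p q -> strictI q r -> r u ->
  exists q', [/\ prime_ideal q', strictI p q', strictI q' r & q' u].
Proof.
move=> pp pq pr [pq_sub [y [qy py]]] lt_qr ru.
have [pu|pu] := classic (p u).
  exists q; split=> //; last exact: pq_sub.
  by split=> //; exists y.
apply: NNPP => no.
have minr P : prime_ideal P -> subI p P -> P u -> subI P r -> subI r P.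
  move=> pP pP_sub Pu Pr a ra; apply: NNPP => Pa; apply: no; exists P.
  by split=> //; split=> //; [exists u | exists a].
have [qr [a0 [ra0 qa0]]] := lt_qr.
have qu : ~ q u by move=> qu; apply: qa0; apply: (minr q).
have [ip p1 pM] := pp; have [p0 pA pZ] := ip.
have [[q0 qA qZ] q1 qM] := pq.
pose Q n : R^o -> Prop := fun a => exists s t, ~ q s /\ p (s * a - t * y ^+ n).
have sQ n : submodule (Q n).
  split=> [|a b [s [t [qs pa]]] [s' [t' [qs' pb]]]|c a [s [t [qs pa]]]].
  - by exists 1, 0; rewrite mulr0 mul0r subr0.
  - exists (s * s'), (s' * t + s * t'); split; first exact: prime_mul_notin.
    have -> : s * s' * (a + b) - (s' * t + s * t') * y ^+ n =
      s' * (s * a - t * y ^+ n) + s * (s' * b - t' * y ^+ n) by ring.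
    by apply: pA; apply: pZ.
  - exists s, (c * t); split=> //.
    have -> : s * (c * a) - c * t * y ^+ n = c * (s * a - t * y ^+ n) by ring.
    exact: pZ.
have satQ n s a : ~ q s -> Q n (s * a) -> Q n a.
  move=> qs [s' [t [qs' pa]]]; exists (s' * s), t; rewrite -mulrA; split=> //.
  exact: prime_mul_notin.
have pQ n : subI p (Q n).
  by move=> a pa; exists 1, 0; rewrite mul1r mul0r subr0.
have QS n : subI (Q n.+1) (Q n).
  by move=> a [s [t [qs pa]]]; exists s, (t * y); rewrite -mulrA -exprS.
pose K : R^o -> Prop := sat r (adjoin (p : R^o -> Prop) (u : R^o)).
have sK : submodule K by apply: sat_submodule => //; apply: adjoin_submodule.
have [|P pP annP Pr|b bnd] := @finite_length_at R R^o r K (acc_regular noeR) noeR pr sK.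
- exact: sat_saturated.
- apply: minr => // [a pa|]; apply: annP => w; apply: sat_sub => //.
    by apply: adjoin_sub; rewrite /GRing.scale /= mulrC; apply: pZ.
  by exists 0, w; split=> //; rewrite add0r /GRing.scale /= mulrC.
have [n|n w [s [rs [a [t [Qa e]]]]]|n JJ] :=
    bounded_chains_dcc (D := fun n => sat r (adjoin (Q n) (u : R^o))) bnd.
- split; [by apply: sat_submodule => //; apply: adjoin_submodule | exact: sat_saturated|].
  apply: sat_min; first exact: sat_saturated.
  move=> w [a [t [pa ->]]]; apply: sat_sub => //; exists a, t; split=> //.
  exact: pQ.
- by exists s; split=> //; exists a, t; split=> //; apply: QS.
(* Since [u] is not in [q], the coefficient [t] of [u] lies in [Q n]. So [Q n] equals
   [Q n.+1 + u Q n] at [r], and Nakayama's lemma applies. *)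
have QQ : subM (Q n) (sat r (Q n.+1)).
  apply: nakayama => //; first exact: acc_regular.
  move=> L sL QL rL v Qv.
  have [s [rs [a [t [Qa e]]]]] := JJ v (sat_sub pr (adjoin_sub _ Qv)).
  exists s; split=> //; rewrite e.
  have Qt : Q n t.
    apply: (satQ n u) => //; rewrite mulrC; apply: (submDr (sQ n) (QS n _ Qa)).
    by rewrite -[t * u]/(t *: (u : R^o)) -e; case: (sQ n) => _ _; apply.
  have [_ LA _] := sL; apply: LA; first exact: QL.
  rewrite /GRing.scale /= mulrC; exact: (rL u t).
have [s [rs [s' [t [qs' pyn]]]]] : sat r (Q n.+1) (y ^+ n).
  by apply: QQ; exists 1, 1; rewrite subrr.
(* As [y] is not in [p], cancelling [y ^+ n] puts [s' * s] in [p + (y)], inside [q], although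
   neither factor is in [q]. *)
have {pyn} : p (y ^+ n * (s' * s - t * y)).
  suff -> : y ^+ n * (s' * s - t * y) = s' * (s *: (y ^+ n : R^o)) - t * y ^+ n.+1 by [].
  by rewrite /GRing.scale /= exprS; ring.
case/pM => [/(prime_X pp)//|/pq_sub pe].
have : q (s' * s) by rewrite -(subrK (t * y) (s' * s)); apply: qA => //; apply: qZ.
by apply: prime_mul_notin => // /qr.
Qed.

(** [prime_between] replaces the second prime from the top by one containing [u]; induction on the
    chain that ends there carries [u] to the bottom, at the cost of one prime. *)
Lemma chain_through u n (p : nat -> R -> Prop) :
  (forall i, (i <= n.+1)%N -> prime_ideal (p i)) ->
  (forall i, (i < n.+1)%N -> strictI (p i) (p i.+1)) -> p n.+1 u ->
  exists q : nat -> R -> Prop,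
    [/\ forall i, (i <= n)%N -> prime_ideal (q i),
        forall i, (i < n)%N -> strictI (q i) (q i.+1),
        subI (p 0%N) (q 0%N), q 0%N u & subI (q n) (p n.+1)].
Proof.
elim: n p => [|n IH] p pp ltp pu.
  by exists (fun=> p 1%N); split=> // [i _|]; [apply: pp | case: (ltp 0%N isT)].
have [q' [pq' lt1 lt2 qu']] : exists q',
    [/\ prime_ideal q', strictI (p n) q', strictI q' (p n.+2) & q' u].
  by apply: (@prime_between _ (p n.+1)); auto.
have [|i||q [pq ltq pq0 q0u qn]] := IH (fun i => if (i <= n)%N then p i else q').
- by move=> i _; case: ifP => // le; apply: pp; do 2 apply: leqW.
- rewrite ltnS => le; rewrite le; case: ifP => [lt|]; first by apply: ltp; do 2 apply: leqW.
  by rewrite ltnNge => /negbFE ge; have -> : i = n by apply/eqP; rewrite eqn_leq le.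
- by rewrite ltnn.
exists (fun i => if (i <= n)%N then q i else p n.+2); split=> //.
- by move=> i _; case: ifP => [|_]; [apply: pq | apply: pp].
- move=> i; rewrite ltnS => le; rewrite le; case: ifP => [lt|]; first exact: ltq.
  rewrite ltnNge => /negbFE ge; have -> : i = n by apply/eqP; rewrite eqn_leq le.
  move: qn; rewrite ltnn => qn; have [q'p [c [pc q'c]]] := lt2.
  by split=> [a /qn /q'p|] //; exists c; split=> // /qn.
- by rewrite ltnn.
Qed.

Lemma exists_maximal_ideal I : ideal I -> ~ I 1 -> exists J, maximal_ideal J /\ subI I J.
Proof.
move: I; pose good (I : R^o -> Prop) := ~ I 1 -> exists J, maximal_ideal J /\ subI I J.
apply: (@noeth_ind R R^o good (acc_regular noeR)) => I iI IH I1.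
have [mI|nI] := classic (maximal_ideal I); first by exists I; split.
have [J [iJ [J1 [IJ [a [Ja Ia]]]]]] : exists J, ideal J /\ ~ J 1 /\ strictI I J.
  apply: NNPP => no; apply: nI; split=> // J iJ J1 IJ a Ja; apply: NNPP => Ia.
  by apply: no; exists J; do !split=> //; exists a.
have [|J' [mJ' JJ']] := IH J iJ _ J1; first by split=> //; exists a.
by exists J'; split=> // b /IJ /JJ'.
Qed.

Lemma minimal_primes (B : R -> Prop) I : ideal I -> exists Ps : seq (R -> Prop),
  (forall P, List.In P Ps -> [/\ prime_ideal P, subI I P & ~ subI B P]) /\
  (forall P, prime_ideal P -> subI I P ->
     subI B P \/ exists Q, List.In Q Ps /\ subI Q P).
Proof.
move: I; apply: (@noeth_ind R R^o _ (acc_regular noeR)) => I iI IH.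
have [I1|I1] := classic (I 1).
  by exists [::]; split=> // P [_ P1 _] /(_ _ I1).
have [pI|npI] := classic (prime_ideal I).
  have [BI|BI] := classic (subI B I).
    by exists [::]; split=> // P _ IP; left=> a /BI /IP.
  exists [:: I]; split=> [P [<-|//]|P pP IP]; first by split.
  by right; exists I; split=> //; left.
have [a [b [Iab [Ia Ib]]]] : exists a b, I (a * b) /\ ~ I a /\ ~ I b.
  apply: NNPP => no; apply: npI; split=> // a b Iab.
  apply: NNPP => nab; apply: no; exists a, b; split=> //.
  by split=> h; apply: nab; [left | right].
have [] := IH _ (adjoin_submodule (a : R^o) iI) (adjoin_strict iI Ia).
move=> Pa [Pa1 Pa2].
have [] := IH _ (adjoin_submodule (b : R^o) iI) (adjoin_strict iI Ib).
move=> Pb [Pb1 Pb2].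
have IaI c : subI I (adjoin (I : R^o -> Prop) (c : R^o)) by apply: adjoin_sub.
exists (Pa ++ Pb); split=> [P /In_cat|P pP IP].
  by case=> [/Pa1|/Pb1] [pP IP BP]; split=> // c Ic; apply: IP; apply: IaI.
have [[P0 PA PZ] _ prP] := pP.
have IcP c : P c -> subI (adjoin (I : R^o -> Prop) (c : R^o)) P.
  by move=> Pc _ [n [t [/IP Pn ->]]]; apply: PA => //; apply: PZ.
have [/IcP IaP|/IcP IbP] := prP a b (IP _ Iab).
  have [|[Q [inQ QP]]] := Pa2 P pP IaP; first by left.
  by right; exists Q; split=> //; apply/In_cat; left.
have [|[Q [inQ QP]]] := Pb2 P pP IbP; first by left.
by right; exists Q; split=> //; apply/In_cat; right.
Qed.

Lemma prime_avoidance J (Ps : seq (R -> Prop)) : ideal J ->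
  (forall P, List.In P Ps -> prime_ideal P /\ ~ subI J P) ->
  exists a, J a /\ forall P, List.In P Ps -> ~ P a.
Proof.
move=> iJ; have [J0 JA JZ] := iJ.
have [k le] := ubnP (size Ps); elim: k Ps le => // k IH [|P Ps] /=.
  by exists 0.
rewrite ltnS => le Hp; have [pP nJP] := Hp P (or_introl erefl).
have [[Q [inQ QP]]|nQ] := classic (exists Q, List.In Q Ps /\ subI Q P).
  have [l1 [l2 e]] := In_split inQ; subst Ps.
  have [||a [Ja avoid]] := IH (P :: (l1 ++ l2)).
  - by move: le; rewrite /= !size_cat /= addnS.
  - move=> P' /= in'; apply: Hp; case: in' => [|/In_cat in']; first by left.
    by right; apply/In_cat; case: in' => ?; [left | right; right].
  exists a; split=> // P' [<-|]; first by apply: avoid; left.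
  move=> /In_cat[in'|[<-|in']].
  + by apply: avoid; right; apply/In_cat; left.
  + by move/QP; apply: avoid; left.
  + by apply: avoid; right; apply/In_cat; right.
have [P' in'|a [Ja avoid]] := IH Ps le; first by apply: Hp; right.
have [Pa|Pa] := classic (P a); last by exists a; split=> // P' [<-|] //; apply: avoid.
(* If [a] falls into [P], it is corrected by [b], the product of an element of [J] and one of each
   [Q], all taken outside [P]. *)
have [b [Jb Pb bPs]] : exists b, [/\ J b, ~ P b & forall Q, List.In Q Ps -> Q b].
  have {le IH avoid} HQ Q : List.In Q Ps -> ideal Q /\ ~ subI Q P.
    move=> inQ; split; last by move=> QP; apply: nQ; exists Q.
    by have [[]] := Hp Q (or_intror inQ).
  elim: Ps HQ {Hp nQ} => [|Q Ps IH] HQ.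
    have [b [Jb Pb]] := not_subset nJP.
    by exists b.
  have [Q' inQ'|b [Jb Pb bPs]] := IH; first by apply: HQ; right.
  have [iQ nQP] := HQ Q (or_introl erefl).
  have [c [Qc Pc]] := not_subset nQP.
  exists (c * b); split; [exact: JZ | exact: prime_mul_notin|].
  move=> Q' [<-|inQ']; first by rewrite mulrC; case: iQ => _ _; apply.
  by have [[_ _ Q'Z] _] := HQ Q' (or_intror inQ'); apply: Q'Z; apply: bPs.
exists (a + b); split; first exact: JA.
have [iP _ _] := pP; move=> Q [<-|inQ].
  by move/(idealDr iP Pa).
have [[iQ _ _] _] := Hp Q (or_intror inQ).
by rewrite addrC => /(idealDr iQ (bPs _ inQ)); apply: avoid.
Qed.

(** A generating set can stand for its ideal, since only the primes containing it matter. *)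
Definition adds A z : R -> Prop := fun a => A a \/ a \in z.

Lemma prime_chain_sub A B n :
  (forall P, prime_ideal P -> subI A P -> subI B P) -> prime_chain A n -> prime_chain B n.
Proof. by move=> AB [p [pp Ap ltp]]; exists p; split=> //; apply: AB => //; apply: pp. Qed.

Lemma prime_chain_leq A k n : (k <= n)%N -> prime_chain A n -> prime_chain A k.
Proof.
move=> le [p [pp Ap ltp]]; exists p; split=> // i lti.
  by apply: pp; apply: leq_trans le.
by apply: ltp; apply: leq_trans le.
Qed.

(** * Chains of primes in a local ring *)

Variable m : R -> Prop.
Hypothesis locR : local_ring m.

Lemma local_unit s : ~ m s -> exists t, t * s = 1.
Proof.
move=> ms; have [mm uniq_m] := locR; apply: NNPP => no.
have i0 : ideal (fun a : R => a = 0).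
  by split=> [//|a b -> ->|r a ->]; rewrite ?addr0 ?mulr0.
have [||J [mJ sJ]] := @exists_maximal_ideal (adjoin ((fun a => a = 0) : R^o -> Prop) (s : R^o)).
- exact: adjoin_submodule.
- by move=> [_ [t [-> e]]]; apply: no; exists t; rewrite e add0r.
apply: ms; apply/(uniq_m J mJ); apply: sJ; exact: adjoin_id.
Qed.

Lemma local_prime : prime_ideal m.
Proof.
have [[im m1 _] _] := locR; split=> // a b mab; apply: NNPP => nab.
have [|t ta] := @local_unit a; first by move=> ma; apply: nab; left.
apply: nab; right; rewrite -[b]mul1r -ta -mulrA; by case: im => _ _; apply.
Qed.

Lemma prime_sub_local P : prime_ideal P -> subI P m.
Proof.
move=> [[_ _ PZ] P1 _] a Pa; apply: NNPP => /local_unit [t ta].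
by apply: P1; rewrite -ta; apply: PZ.
Qed.

(** Raising the top prime of the chain to [m] puts [u] in it, so that [chain_through] applies. *)
Lemma chain_cut A u n : m u -> prime_chain A n.+1 -> prime_chain (adds A [:: u]) n.
Proof.
move=> mu [p [pp Ap ltp]].
have [|i||q [pq ltq pq0 q0u _]] := @chain_through u n (fun i => if (i <= n)%N then p i else m).
- by move=> i _; case: ifP => [le|_]; [apply: pp; apply: leqW | exact: local_prime].
- rewrite ltnS => le; rewrite le; case: ifP => [lt|]; first by apply: ltp; apply: leqW.
  rewrite ltnNge => /negbFE ge; have -> : i = n by apply/eqP; rewrite eqn_leq le.
  have [le1 [a [pa npa]]] := ltp n (leqnn _).
  have pm := prime_sub_local (pp n.+1 (leqnn _)).
  by split=> [b /le1 /pm|] //; exists a; split=> //; apply: pm.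
- by rewrite ltnn.
exists q; split=> // a [/Ap /pq0 //|]; by rewrite inE => /eqP->.
Qed.

Lemma chain_cuts A z n : (forall a, a \in z -> m a) ->
  prime_chain A (n + size z) -> prime_chain (adds A z) n.
Proof.
elim: z A n => [|u z IH] A n mz.
  by rewrite addn0; apply: prime_chain_sub => P _ AP a [/AP|].
rewrite /= addnS => /(chain_cut (mz _ (mem_head _ _))) /IH h.
have := h (fun a az => mz a (mem_behead (s := u :: z) az)).
apply: prime_chain_sub => P _ AP a [Aa|]; first by apply: AP; left; left.
rewrite inE => /orP[/eqP->|az]; apply: AP; [left; right; exact: mem_head | by right].
Qed.

(** The unit ideal is allowed: this says that the quotient by [A] has dimension at most 0. *)
Definition m_primary A : Prop := forall P, prime_ideal P -> subI A P -> subI m P.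

Lemma m_primary_sub A B : subI A B -> m_primary A -> m_primary B.
Proof. by move=> AB mA P pP BP; apply: mA => // a /AB /BP. Qed.

Lemma m_primary_no_chain A z : (forall a, a \in z -> m a) ->
  m_primary (adds A z) -> ~ prime_chain A (size z).+1.
Proof.
move=> mz prim; rewrite -add1n => /(chain_cuts mz) [p [pp Ap /(_ 0%N isT) [_ [a [p1a p0a]]]]].
apply: p0a; apply: (prim (p 0%N)) => //; first exact: pp.
by apply: prime_sub_local p1a; apply: pp.
Qed.

Lemma no_chain_m_primary A : ~ prime_chain A 1 -> m_primary A.
Proof.
move=> no P pP AP a ma; apply: NNPP => Pa; apply: no.
exists (fun i => if i is 0%N then P else m); split=> // [[|i] _|[|//] _] //.
  exact: local_prime.
by split; [exact: prime_sub_local | exists a].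
Qed.

(** [a] is chosen outside finitely many primes other than [m], among them the minimal primes of each
    [A i]. A chain over [A i] and [a] then lengthens downwards: its lowest prime is not [m], as
    [0 < n], and strictly contains one of the avoided primes. *)
Lemma parameter_avoidance (T : eqType) (s : seq T) (A : T -> R -> Prop) J : ideal J ->
  (forall i, i \in s -> forall P, prime_ideal P -> subI (A i) P ->
     ~ subI m P -> ~ subI J P) ->
  exists a, J a /\ forall i, i \in s -> forall n, (0 < n)%N ->
    ~ prime_chain (A i) n.+1 -> ~ prime_chain (adds (A i) [:: a]) n.
Proof.
move=> iJ HJ.
have [Ps [Ps1 Ps2]] : exists Ps : seq (R -> Prop),
    (forall P, List.In P Ps -> prime_ideal P /\ ~ subI J P) /\
    (forall i, i \in s -> forall P, prime_ideal P -> subI (A i) P -> subI m P \/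
      exists Q, [/\ List.In Q Ps, prime_ideal Q, subI (A i) Q & subI Q P]).
  elim: s HJ => [|i s IH] HJ; first by exists [::].
  have [j js|Ps [Ps1 Ps2]] := IH; first by apply: HJ; rewrite inE js orbT.
  have genA : subI (A i) (gen_ideal (A i)) by move=> a Aa K _; apply.
  have [Qs [Qs1 Qs2]] := minimal_primes m (gen_ideal_ideal (A i)).
  exists (Qs ++ Ps); split=> [P /In_cat[/Qs1[pP AP mP]|/Ps1//]|j].
    by split=> //; apply: HJ mP => //; [exact: mem_head | move=> a /genA /AP].
  rewrite inE => /orP[/eqP->|js] P pP AP.
  - have [|mP|[Q [inQ QP]]] := Qs2 P pP; [|by left|].
      by move=> a Aa; apply: Aa => //; case: pP.
    have [pQ AQ _] := Qs1 _ inQ.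
    right; exists Q; split=> // [|a /genA /AQ //].
    by apply/In_cat; left.
  - have [|[Q [inQ pQ AQ QP]]] := Ps2 _ js P pP AP; first by left.
    by right; exists Q; split=> //; apply/In_cat; right.
have [a [Ja avoid]] := prime_avoidance iJ Ps1.
exists a; split=> // i si [//|n] _ no [p [pp Ap ltp]].
have p0 := pp 0%N isT.
have Ap0 : subI (A i) (p 0%N) by move=> b Ab; apply: Ap; left.
have p0a : p 0%N a by apply: Ap; right; apply: mem_head.
have [mp0|[Q [inQ pQ AQ Qp0]]] := Ps2 i si _ p0 Ap0.
  have [_ [b [p1b p0b]]] := ltp 0%N isT.
  by apply: p0b; apply: mp0; apply: prime_sub_local p1b; apply: pp.
apply: no; exists (fun i => if i is i'.+1 then p i' else Q).
split=> // [[|j] ltj|[|j] ltj] //; [exact: pp| |exact: ltp].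
by split=> //; exists a; split=> //; apply: avoid.
Qed.

End Dimension.


(** * Socle dimensions *)

Section Socle.
Variables (R : comNzRingType) (M : lmodType R) (m : R -> Prop).
Hypotheses (noeR : noetherian R) (locR : local_ring m) (accM : acc_submodules M).
Implicit Types (K N Q H : M -> Prop) (B I J : R -> Prop).

Lemma socle_submodule Q : submodule Q -> submodule (socle m Q).
Proof.
move=> [Q0 QA QZ]; split=> [r _|u v Qu Qv r mr|a v Qv r mr].
- by rewrite scaler0.
- by rewrite scalerDr; apply: QA; [apply: Qu | apply: Qv].
- by rewrite scalerA mulrC -scalerA; apply: QZ; apply: Qv.
Qed.

Lemma socle_mono Q Q' : subM Q Q' -> subM (socle m Q) (socle m Q').
Proof. by move=> QQ' v Qv r /Qv /QQ'. Qed.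

(** Noetherian induction on [N] between [K] and the socle gives a finite basis of the socle modulo
    [N]: an element [v0] outside [N] is added to a basis modulo [N + R v0]. *)
Lemma socle_kdim_exists K : submodule K -> exists q, socle_kdim m K q.
Proof.
move=> sK; have sA := socle_submodule sK.
suff gen N : submodule N -> subM K N /\ subM N (socle m K) -> exists q (v : 'I_q -> M),
    [/\ forall i, socle m K (v i),
        (forall w, socle m K w -> exists c : 'I_q -> R, N (w - \sum_(i < q) c i *: v i)) &
        (forall c : 'I_q -> R, N (\sum_(i < q) c i *: v i) -> forall i, m (c i))].
  have [|q [v Hv]] := gen K sK; last by exists q, v.
  by split=> // v Kv r _; case: sK => _ _; apply.
move: N; apply: noeth_ind => // N sN IH [KN NA].
have [AN|/not_subset [v0 [Av0 Nv0]]] := classic (forall v, socle m K v -> N v).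
  exists 0%N, (fun=> 0); split=> [[]//|w Aw|c _ []//].
  by exists (fun=> 0); rewrite big_ord0 subr0; apply: AN.
have [|q [v [Av span indep]]] := IH _ (adjoin_submodule v0 sN) (adjoin_strict sN Nv0).
  split; first by move=> w /KN; apply: adjoin_sub.
  exact: adjoin_min.
pose cons T (x : T) (f : 'I_q -> T) (i : 'I_q.+1) := if unlift ord0 i is Some j then f j else x.
have cons0 T (x : T) f : cons T x f ord0 = x by rewrite /cons unlift_none.
have consS T (x : T) f i : cons T x f (lift ord0 i) = f i by rewrite /cons liftK.
exists q.+1, (cons _ v0 v); split=> [i|w Aw|c].
- by rewrite /cons; case: unliftP => [j _|_].
- have [c [n [t [Nn e]]]] := span w Aw.
  exists (cons _ t c); rewrite big_ord_recl !cons0.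
  under eq_bigr do rewrite !consS.
  by rewrite opprD addrCA e addrCA addNr addr0.
- rewrite big_ord_recl cons0; under eq_bigr do rewrite consS.
  move=> Nc; have mc : forall i, m (c (lift ord0 i)).
    apply: (indep (fun i => c (lift ord0 i))).
    exists (c ord0 *: v0 + \sum_(i < q) c (lift ord0 i) *: v i), (- c ord0).
    by split=> //; rewrite scaleNr addrC addKr.
  have Nc0 : N (c ord0 *: v0).
    apply: submDl Nc => //; apply: subm_sum => // i; apply: KN; exact: Av.
  move=> i; case: (unliftP ord0 i) => [j ->|->]; first exact: mc.
  apply: NNPP => /(local_unit noeR locR) [t tc]; apply: Nv0.
  by rewrite -[v0]scale1r -tc -scalerA; case: sN => _ _; apply.
Qed.

(** [T] presents a linear isomorphism of socles on representatives: it is total on both sides, and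
    its compatibility with [Q] and [Q'] makes it well defined and injective. *)
Lemma socle_kdim_transfer Q Q' (T : M -> M -> Prop) n :
  T 0 0 -> (forall u u' v v', T u u' -> T v v' -> T (u + v) (u' + v')) ->
  (forall r v v', T v v' -> T (r *: v) (r *: v')) ->
  (forall v, socle m Q v -> exists v', socle m Q' v' /\ T v v') ->
  (forall v', socle m Q' v' -> exists v, socle m Q v /\ T v v') ->
  (forall v v', T v v' -> Q v <-> Q' v') ->
  socle_kdim m Q n -> socle_kdim m Q' n.
Proof.
move=> T0 TD TZ totl totr TQ [v [Qv span indep]].
have [v' Hv'] : exists v' : 'I_n -> M, forall i, socle m Q' (v' i) /\ T (v i) (v' i).
  by apply: (fin_all_exists (P := fun i v' => socle m Q' v' /\ T (v i) v')) => i; apply: totl.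
have Tsum (c : 'I_n -> R) : T (\sum_(i < n) c i *: v i) (\sum_(i < n) c i *: v' i).
  by apply: big_rec2 => // i x x' _ Txx'; apply: TD => //; apply: TZ; case: (Hv' i).
exists v'; split=> [i|w' Qw'|c Qc].
- by case: (Hv' i).
- have [w [Qw Tww']] := totr w' Qw'; have [c Qwc] := span w Qw.
  exists c; move: Qwc; rewrite -!scaleN1r => Qwc.
  by apply/(TQ _ _ (TD _ _ _ _ Tww' (TZ (-1) _ _ (Tsum c)))).
- by apply: indep; apply/(TQ _ _ (Tsum c)).
Qed.

Lemma socle_kdim_eq Q Q' n : (forall v, Q v <-> Q' v) -> socle_kdim m Q n <-> socle_kdim m Q' n.
Proof.
move=> QQ'; have soc v : socle m Q v <-> socle m Q' v.
  by split=> Qv r /Qv /QQ'.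
by split; apply: (@socle_kdim_transfer _ _ (fun v v' => v = v')) => //;
  try (by move=> ? ? ? ? -> ->); try (by move=> ? ? ? ->); try (by move=> ? ? ->; split=> /QQ');
  by move=> v /soc Qv; exists v.
Qed.

Definition mprod B : R -> Prop :=
  gen_ideal (fun x => exists r b, [/\ m r, B b & x = r * b]).

Lemma mprod_sub B : ideal B -> subI (mprod B) B.
Proof. by move=> iB a; apply=> // _ [r [b [_ Bb ->]]]; case: iB => _ _; apply. Qed.

Lemma mprod_local B : subI (mprod B) m.
Proof.
have [im _ _] := local_prime noeR locR.
by move=> a; apply=> // _ [r [b [mr _ ->]]]; rewrite mulrC; case: im => _ _; apply.
Qed.

(** * Exchange of one parameter *)

Section Swap.
Variables (K : M -> Prop) (B : R -> Prop).
Hypotheses (sK : submodule K) (iB : ideal B).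

Let H : M -> Prop := fun v => forall b, B b -> K (b *: v).

(* [a] annihilates [H / K] and is a nonzerodivisor on [M / H]. *)
Definition swappable a : Prop :=
  mprod B a /\ forall v, K ((a * a) *: v) -> forall b, B b -> K (b *: v).

Let sH : submodule H.
Proof.
have [K0 KA KZ] := sK; split=> [b _|u v Hu Hv b Bb|r v Hv b Bb].
- by rewrite scaler0.
- by rewrite scalerDr; apply: KA; [apply: Hu | apply: Hv].
- by rewrite scalerA mulrC -scalerA; apply: KZ; apply: Hv.
Qed.

Let KH : subM K H.
Proof. by move=> v Kv b _; case: sK => _ _; apply. Qed.

(** [a] lies in [B], so [a *: v] in [H] gives [(a * a) *: v] in [K]. *)
Let regular a v : swappable a -> H (a *: v) -> H v.
Proof. by move=> [/(mprod_sub iB) Ba reg] /(_ a Ba); rewrite scalerA; apply: reg. Qed.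

(** This is the injectivity of [H / K -> M / (K + a M)]: if [k + a *: w] is in [H], then so is [w],
    and [a] kills [H / K]. *)
Let capH a h : swappable a -> add_smul K a h -> H h -> K h.
Proof.
move=> sa [k [w [Kk e]]] Hh; have [_ KA _] := sK.
have Hw : H w.
  by apply: (regular sa); apply: (submDr sH (KH Kk)); rewrite -e.
by rewrite e; apply: KA => //; apply: Hw; apply: (mprod_sub iB); case: sa.
Qed.

(* A socle element [v] of [M / (H + a M)] comes with the relation
   [r v = a n mod H]. The set of the [c] for which some [w] satisfies [r w = c n mod K]
   is an ideal, and it contains [r0 * b] for [r0] in [m] and [b] in [B], with witness
   [b *: n0] where [r0 v = a n0 mod H]. *)
Let lift a v : swappable a -> socle m (add_smul H a) v ->
  exists w, socle m (add_smul K a) w /\ H (w - v).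
Proof.
move=> sa Hv; have [[_ mA mZ] _ _] := local_prime noeR locR.
have [K0 KA KZ] := sK; have [H0 HA HZ] := sH.
pose F r n := H (r *: v - a *: n).
pose G c := exists w, (forall r n, m r -> F r n -> K (r *: w - c *: n)) /\ H (a *: w - c *: v).
have exF r : m r -> exists n, F r n.
  by move=> /Hv [h [n [Hh e]]]; exists n; rewrite /F e addrK.
have : G a.
  have [sub _] := sa; apply: sub => [|_ [r0 [b [mr0 Bb ->]]]].
    split=> [|c c' [w [Kw Hw]] [w' [Kw' Hw']]|t c [w [Kw Hw]]].
    - exists 0; split=> [r n _ _|]; first by rewrite scaler0 scale0r subr0.
      by rewrite scaler0 scale0r subr0.
    - exists (w + w'); split=> [r n mr Frn|]; rewrite scalerDr scalerDl opprD addrACA.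
        by apply: KA; [apply: Kw | apply: Kw'].
      exact: HA.
    - exists (t *: w); split=> [r n mr Frn|].
        by rewrite scalerA mulrC -!scalerA -scalerBr; apply: KZ; apply: Kw.
      by rewrite scalerA mulrC -!scalerA -scalerBr; apply: HZ.
  have [n0 Fn0] := exF r0 mr0; exists (b *: n0); split=> [r n mr Frn|].
    have -> : r *: (b *: n0) - (r0 * b) *: n = b *: (r *: n0 - r0 *: n).
      by rewrite scalerBr !scalerA [r * b]mulrC [r0 * b]mulrC.
    suff: H (r *: n0 - r0 *: n) by apply.
    apply: (regular sa).
    have -> : a *: (r *: n0 - r0 *: n) =
        r0 *: (r *: v - a *: n) - r *: (r0 *: v - a *: n0).
      rewrite !scalerBr !scalerA [r0 * r]mulrC [r * a]mulrC [r0 * a]mulrC.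
      by rewrite opprB [RHS]addrC addrA subrK.
    by apply: (submB sH); apply: HZ.
  have -> : a *: (b *: n0) - (r0 * b) *: v = - b *: (r0 *: v - a *: n0).
    by rewrite scaleNr scalerBr opprB !scalerA [a * b]mulrC [r0 * b]mulrC.
  exact: HZ.
move=> [w [Kw Hw]]; exists w; split; last by apply: (regular sa); rewrite scalerBr.
move=> r mr; have [n Frn] := exF r mr.
by exists (r *: w - a *: n), n; split; [apply: Kw | rewrite subrK].
Qed.

(** The socles for [a] and [a'] are matched by [a' v = a v'] modulo [H + a a' M]. Since [a'] is in
    [m], [a' *: v] lies in [H + a M], which provides [v']; cancelling [a] shows that [v'] is a socle
    element. *)
Let cross_socle a a' v : swappable a -> swappable a' -> socle m (add_smul H a) v ->
  exists v', socle m (add_smul H a') v' /\ add_smul H (a * a') (a' *: v - a *: v').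
Proof.
move=> sa sa' Hv; have [H0 HA HZ] := sH.
have [h [v' [Hh e]]] := Hv a' (mprod_local sa'.1).
exists v'; split; last first.
  by rewrite e addrK; apply: add_smul_sub.
move=> r mr; have [h1 [n [Hh1 e1]]] := Hv r mr.
exists (r *: v' - a' *: n), n; split; last by rewrite subrK.
apply: (regular sa).
have -> : a *: (r *: v' - a' *: n) = a' *: h1 - r *: h.
  have -> : h = a' *: v - a *: v' by rewrite e addrK.
  have -> : h1 = r *: v - a *: n by rewrite e1 addrK.
  rewrite !scalerBr !scalerA [a' * r]mulrC [a' * a]mulrC [a * r]mulrC.
  by rewrite opprB [RHS]addrC addrA subrK.
by apply: (submB sH); apply: HZ.
Qed.

(** This makes the matching well defined and, with [a] and [a'] exchanged, injective. *)
Let cross_zero a a' v v' : swappable a -> add_smul H (a * a') (a' *: v - a *: v') ->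
  add_smul H a v -> add_smul H a' v'.
Proof.
move=> sa [h [n [Hh e]]] [h1 [n1 [Hh1 e1]]]; have [_ HA HZ] := sH.
exists (v' - a' *: (n1 - n)), (n1 - n); split; last by rewrite subrK.
apply: (regular sa).
have -> : a *: (v' - a' *: (n1 - n)) = a' *: h1 - h.
  have -> : h = a' *: v - a *: v' - (a * a') *: n by rewrite e addrK.
  have -> : h1 = v - a *: n1 by rewrite e1 addrK.
  rewrite !scalerBr !scalerA [a' * a]mulrC !opprB [RHS]addrC -!addrA addKr.
  by rewrite addrCA.
by apply: (submB sH) => //; apply: HZ.
Qed.

(** Both socles are described by the same data: an element of the socle of [H / K] and [q]
    coefficients modulo [m], where [q] is the common socle dimension of [M / (H + a M)] and
    [M / (H + a' M)]. Elements with equal data are matched. *)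
Lemma socle_swap a a' n : swappable a -> swappable a' ->
  socle_kdim m (add_smul K a) n -> socle_kdim m (add_smul K a') n.
Proof.
move=> sa sa'.
have [q be] := socle_kdim_exists (add_smul_submodule a sH).
have be' : socle_kdim m (add_smul H a') q.
  move: be.
  apply: (@socle_kdim_transfer _ _ (fun v v' => add_smul H (a * a') (a' *: v - a *: v'))).
  - by rewrite !scaler0 subr0; case: (add_smul_submodule (a * a') sH).
  - move=> u u' v v' Tu Tv; rewrite !scalerDr opprD addrACA.
    by case: (add_smul_submodule (a * a') sH) => _ HA _; apply: HA.
  - move=> r v v' Tv; have [_ _ HZ] := add_smul_submodule (a * a') sH.
    suff -> : a' *: (r *: v) - a *: (r *: v') = r *: (a' *: v - a *: v') by apply: HZ.
    by rewrite scalerBr !scalerA [r * a']mulrC [r * a]mulrC.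
  - by move=> v; apply: cross_socle.
  - move=> v' /(cross_socle sa' sa) [v [Hv Tv]]; exists v; split=> //.
    rewrite -opprB mulrC -scaleN1r.
    by case: (add_smul_submodule (a' * a) sH) => _ _; apply.
  - move=> v v' Tv; split; first exact: cross_zero Tv.
    apply: (cross_zero sa'); rewrite -opprB mulrC -scaleN1r.
    by case: (add_smul_submodule (a * a') sH) => _ _; apply.
(* Lifts [w] of a basis give coordinates: a socle element of [M / (K + c M)] is [h] plus a
   combination of the [w i], and it vanishes exactly when [h] is in [K] and the coefficients are in
   [m]. *)
have lifted c : swappable c -> socle_kdim m (add_smul H c) q ->
    exists w : 'I_q -> M, [/\ forall i, socle m (add_smul K c) (w i),
      (forall v, socle m (add_smul K c) v -> exists (t : 'I_q -> R) h, [/\ H h,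
         add_smul K c (v - (h + \sum_(i < q) t i *: w i)) & socle m K h]) &
      (forall (t : 'I_q -> R) h, H h ->
         add_smul K c (h + \sum_(i < q) t i *: w i) <-> K h /\ forall i, m (t i))].
  move=> sc [e [He span indep]].
  have sKc := add_smul_submodule c sK; have sHc := add_smul_submodule c sH.
  have [w Hw] : exists w : 'I_q -> M, forall i, socle m (add_smul K c) (w i) /\ H (w i - e i).
    by apply: (fin_all_exists (P := fun i w => socle m (add_smul K c) w /\ H (w - e i))) => i;
      apply: lift.
  have KcHc : subM (add_smul K c) (add_smul H c).
    by move=> _ [k [u [Kk ->]]]; exists k, u; split=> //; apply: KH.
  have Hsum (t : 'I_q -> R) : H (\sum_(i < q) t i *: w i - \sum_(i < q) t i *: e i).
    rewrite -sumrB; apply: (subm_sum sH) => i; rewrite -scalerBr.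
    by case: (Hw i) => _ Hwi; case: sH => _ _; apply.
  exists w; split=> [i|v Kv|t h Hh].
  - by case: (Hw i).
  - have [t [h [u [Hh eq]]]] := span v (socle_mono KcHc Kv).
    (* The passage from the basis [e] to its lifts [w] is absorbed into the part in [H]. *)
    pose h' := h - (\sum_(i < q) t i *: w i - \sum_(i < q) t i *: e i).
    have Hh' : H h' by apply: (submB sH).
    have eq' : v - (h' + \sum_(i < q) t i *: w i) = c *: u.
      have ev : v = h + c *: u + \sum_(i < q) t i *: e i by rewrite -eq subrK.
      by rewrite /h' opprB -addrA subrK ev [h + _ + _]addrAC [_ + c *: u]addrC addrK.
    exists t, h'; split=> //; rewrite ?eq'; first exact: add_smul_smul.
    move=> r mr; apply: (capH sc); last by case: sH => _ _; apply.
    have -> : h' = v - c *: u - \sum_(i < q) t i *: w i.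
      by rewrite -eq' opprB [v + _]addrC subrK addrK.
    rewrite !scalerBr; apply: (submB sKc); first apply: (submB sKc).
    + exact: Kv.
    + by rewrite scalerA mulrC -scalerA; apply: add_smul_smul.
    + rewrite scaler_sumr; apply: subm_sum => // i.
      rewrite scalerA mulrC -scalerA; have [_ _ KcZ] := sKc; apply: KcZ.
      by case: (Hw i) => + _; apply.
  - have Kt : (forall i, m (t i)) -> add_smul K c (\sum_(i < q) t i *: w i).
      by move=> mt; apply: subm_sum => // i; case: (Hw i) => + _; apply.
    split=> [Kht|[Kh mt]]; last first.
      by case: sKc => _ KA _; apply: KA; [exact: add_smul_sub | exact: Kt].
    have mt : forall i, m (t i).
      apply: indep; apply: (submDr sHc (add_smul_sub _ (Hsum t))); rewrite subrK.
      by apply: (submDr sHc (add_smul_sub _ Hh)); apply: KcHc.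
    split=> //; apply: (capH sc) => //; apply: (submDl sKc (Kt mt)) => //.
have [w [Kw totl iffl]] := lifted a sa be.
have [w' [Kw' totr iffr]] := lifted a' sa' be'.
have sKa := add_smul_submodule a sK; have sKa' := add_smul_submodule a' sK.
have [H0 HA HZ] := sH.
pose T v v' := exists (t : 'I_q -> R) h, [/\ H h,
  add_smul K a (v - (h + \sum_(i < q) t i *: w i)) &
  add_smul K a' (v' - (h + \sum_(i < q) t i *: w' i))].
have partner c (u : 'I_q -> M) (t : 'I_q -> R) h :
    (forall i, socle m (add_smul K c) (u i)) -> socle m K h ->
    socle m (add_smul K c) (h + \sum_(i < q) t i *: u i).
  have [_ SA SZ] := socle_submodule (add_smul_submodule c sK).
  move=> Ku Kh; apply: SA; first by apply: socle_mono Kh; apply: add_smul_sub.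
  by apply: subm_sum => [|i]; [apply: socle_submodule; apply: add_smul_submodule | apply: SZ].
apply: (@socle_kdim_transfer _ _ T).
- exists (fun=> 0), 0; rewrite !big1 ?addr0 ?subr0 => [|i _|i _]; rewrite ?scale0r //.
  by split=> //; [case: sKa | case: sKa'].
- move=> u u' v v' [t [h [Hh Ku Ku']]] [t2 [h2 [Hh2 Kv Kv']]].
  have sumD (f : 'I_q -> M) : \sum_(i < q) (t i + t2 i) *: f i =
      \sum_(i < q) t i *: f i + \sum_(i < q) t2 i *: f i.
    by rewrite -big_split; apply: eq_bigr => i _; rewrite scalerDl.
  have regroup (x y s s2 : M) : x + y - (h + h2 + (s + s2)) = x - (h + s) + (y - (h2 + s2)).
    by rewrite [h + h2 + _]addrACA opprD addrACA.
  exists (fun i => t i + t2 i), (h + h2); rewrite !sumD !regroup.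
  split; first exact: HA.
    by case: sKa => _ KA _; apply: KA.
  by case: sKa' => _ KA _; apply: KA.
- move=> r v v' [t [h [Hh Kv Kv']]]; exists (fun i => r * t i), (r *: h).
  have sumZ (f : 'I_q -> M) : \sum_(i < q) (r * t i) *: f i = r *: \sum_(i < q) t i *: f i.
    by rewrite scaler_sumr; apply: eq_bigr => i _; rewrite scalerA.
  rewrite !sumZ -!scalerDr -!scalerBr; split; first exact: HZ.
    by case: sKa => _ _; apply.
  by case: sKa' => _ _; apply.
- move=> v /totl [t [h [Hh Kv Kh]]]; exists (h + \sum_(i < q) t i *: w' i).
  split; first exact: partner.
  by exists t, h; rewrite subrr; split=> //; case: sKa'.
- move=> v /totr [t [h [Hh Kv Kh]]]; exists (h + \sum_(i < q) t i *: w i).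
  split; first exact: partner.
  by exists t, h; rewrite subrr; split=> //; case: sKa.
- move=> v v' [t [h [Hh Kv Kv']]].
  have mod N x y : submodule N -> N (x - y) -> N x <-> N y.
    by move=> sN Nxy; split=> [|Ny]; [rewrite -{1}[x](subrK y); apply: submDr |
      rewrite -[x](subrK y); case: sN => _ NA _; apply: NA].
  by rewrite (mod _ _ _ sKa Kv) (mod _ _ _ sKa' Kv') iffl // iffr.
Qed.

End Swap.
End Socle.


(** * Submodules generated by sequences *)

Section SubGen.
Variables (R : comNzRingType) (M : lmodType R).
Implicit Types (K N : M -> Prop) (s t z : seq R).

Lemma sub_gen_submodule K z : submodule K -> submodule (sub_gen K z).
Proof.
move=> sK; split=> [N sN _ _|u v Ku Kv N sN KN zN|r v Kv N sN KN zN].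
- by case: sN.
- by case: (sN) => _ NA _; apply: NA; [apply: Ku | apply: Kv].
- by case: (sN) => _ _; apply; apply: Kv.
Qed.

Lemma sub_gen_sub K z : subM K (sub_gen K z).
Proof. by move=> v Kv N _ KN _; apply: KN. Qed.

Lemma sub_gen_mem K z a w : a \in z -> sub_gen K z (a *: w).
Proof. by move=> /(nthP 0)[j lt <-] N _ _; apply. Qed.

Lemma sub_gen_min K z N : submodule N -> subM K N ->
  (forall a w, a \in z -> N (a *: w)) -> subM (sub_gen K z) N.
Proof. by move=> sN KN zN v; apply=> // j w lt; apply: zN; apply: mem_nth. Qed.

(** This orders the generators as the exchange needs them: [t], whose quotient defines the ideal
    [bideal], then [z], then the exchanged [a]. *)
Lemma sub_gen_add_smul K s t z a v : submodule K -> s =i a :: (z ++ t) ->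
  sub_gen K s v <-> add_smul (sub_gen (sub_gen K t) z) a v.
Proof.
move=> sK es; have sKt := sub_gen_submodule t sK; have sKs := sub_gen_submodule s sK.
have sKtz := sub_gen_submodule z sKt.
split; last first.
  move=> [n [w [Kn ->]]]; have [_ KA _] := sKs; apply: KA; last first.
    by apply: sub_gen_mem; rewrite es mem_head.
  move: n Kn; apply: sub_gen_min => //.
    apply: sub_gen_min => //; first exact: sub_gen_sub.
    by move=> b u bt; apply: sub_gen_mem; rewrite es inE mem_cat bt !orbT.
  by move=> b u bz; apply: sub_gen_mem; rewrite es inE mem_cat bz orbT.
move: v; apply: sub_gen_min; first exact: add_smul_submodule.
  by move=> v Kv; apply: add_smul_sub; do 2!apply: sub_gen_sub.
move=> b w; rewrite es inE mem_cat => /or3P[/eqP->|bz|bt].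
- exact: add_smul_smul.
- by apply: add_smul_sub; apply: sub_gen_mem.
- by apply: add_smul_sub; apply: sub_gen_sub; apply: sub_gen_mem.
Qed.

Lemma bideal_ideal (m : R -> Prop) K : submodule K -> ideal (bideal m K).
Proof.
move=> sK; split=> [z _ i _ v _|a b Ba Bb z sz i lti v zv|r a Ba z sz i lti v zv];
  have [K0 KA KZ] := sub_gen_submodule (take i z) sK.
- by rewrite scale0r.
- by rewrite scalerDl; apply: KA; [apply: Ba zv | apply: Bb zv].
- by rewrite -scalerA; apply: KZ; apply: Ba zv.
Qed.

Lemma ann_quot_bideal (m : R -> Prop) K : subI (ann_quot K) (bideal m K).
Proof. by move=> a Ka z _ i _ v _; apply: sub_gen_sub. Qed.

End SubGen.

(** * Systems of parameters and m-primary ideals *)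

Section Sop.
Variables (R : comNzRingType) (M : lmodType R) (m : R -> Prop).
Hypotheses (noeR : noetherian R) (locR : local_ring m) (fgM : fin_gen M).
Implicit Types (K N : M -> Prop) (t z : seq R) (P : R -> Prop).

Let accM : acc_submodules M := acc_fin_gen noeR fgM.
Let pm := local_prime noeR locR.
Local Notation Ann := (ann_quot (@zero_sub R M)).

Lemma saturated_local N : submodule N -> saturated m N.
Proof.
move=> [_ _ NZ] s v /(local_unit noeR locR) [t ts] Nsv.
by rewrite -[v]scale1r -ts -scalerA; apply: NZ.
Qed.

Lemma m_primary_finite_length K : submodule K -> m_primary m (ann_quot K) -> finite_length K.
Proof.
move=> sK prim.
have [|P pP annP _|b bnd] := finite_length_at accM noeR pm sK.
- exact: saturated_local.
- exact: prim.
exists b => k N HN ltN; apply: bnd ltN => i /HN [sN KN].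
by split=> //; apply: saturated_local.
Qed.

Lemma torsion_annihilator P : prime_ideal P ->
  (forall v : M, exists s, ~ P s /\ s *: v = 0) -> exists s, ~ P s /\ Ann s.
Proof.
move=> pP tors; have [g gen] := fgM.
have [s [Ps sg]] : exists s, ~ P s /\ forall v, v \in g -> s *: v = 0.
  elim: g {gen} => [|v g [s [Ps sg]]]; first by exists 1; case: pP.
  have [t [Pt tv]] := tors v; exists (s * t); split; first exact: prime_mul_notin.
  move=> w; rewrite inE => /orP[/eqP->|/sg sw]; first by rewrite -scalerA tv scaler0.
  by rewrite mulrC -scalerA sw scaler0.
exists s; split=> // v; have [c ->] := gen v; rewrite /zero_sub scaler_sumr big1 // => i _.
by rewrite scalerA mulrC -scalerA sg ?scaler0 // mem_nth.
Qed.

(** If some [c] outside [P] kills [M / z M], then [M = z M] at [P] with [z] in [P]. By Nakayama's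
    lemma [M] vanishes at [P], so its annihilator is not inside [P]. *)
Lemma prime_ann_quot P z : prime_ideal P -> subI (adds Ann z) P ->
  subI (ann_quot (sub_gen (@zero_sub R M) z)) P.
Proof.
move=> pP AP c cM; apply: NNPP => Pc.
have : subM (fun _ : M => True) (sat P (@zero_sub R M)).
  apply: nakayama => //; first exact: zero_submodule.
  move=> L sL zL PL v _; exists c; split=> //; move: (c *: v) (cM v).
  apply: sub_gen_min => // a w az; apply: PL => //; apply: AP; by right.
move=> tors; have [s [Ps As]] : exists s, ~ P s /\ Ann s.
  by apply: torsion_annihilator => // v; have [s [Ps sv]] := tors v I; exists s.
by apply: Ps; apply: AP; left.
Qed.

(** For [a] in [m], finite length makes the submodules [Q + a ^+ n M] stationary, where [Q = z M].
    Nakayama's lemma puts [a ^+ n M] in [Q], and [prime_ann_quot] puts [a ^+ n] in [P]. *)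
Lemma finite_length_m_primary z : finite_length (sub_gen (@zero_sub R M) z) ->
  m_primary m (adds Ann z).
Proof.
set Q := sub_gen _ z => -[b fl] P pP AP a ma.
have sQ : submodule Q by apply: sub_gen_submodule; apply: zero_submodule.
have bnd : bounded_chains m Q b.
  by move=> k N HN; apply: fl => i /HN [].
have sD n := add_smul_submodule (a ^+ n) sQ.
have [n|n w [q [v [Qq ->]]]|n DD] := bounded_chains_dcc (D := fun n => add_smul Q (a ^+ n)) bnd.
- by split=> //; [exact: saturated_local | exact: add_smul_sub].
- by exists q, (a *: v); rewrite scalerA -exprSr.
apply: (@prime_X _ _ _ n pP); apply: (prime_ann_quot pP AP) => v.
have : sat m Q (a ^+ n *: v).
  have nak : subM (add_smul Q (a ^+ n)) (sat m Q).
    apply: nakayama => // L sL QL mL w /DD [q [u [Qq ->]]].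
    exists 1; split; first by case: pm.
    rewrite scale1r exprS -scalerA; have [_ LA _] := sL; apply: LA; first exact: QL.
    by apply: mL => //; apply: add_smul_smul.
  by apply: nak; apply: add_smul_smul.
by apply: sat_min => //; apply: saturated_local.
Qed.

(** Cutting by [t] lowers the dimension by at most [size t], which bounds the dimension of [M / t M]
    from below; the m-primary ideal obtained by adding [z] bounds it from above. *)
Lemma sop_quotient t z : module_dim (@zero_sub R M) (size z + size t) ->
  (forall a, a \in z -> m a) -> (forall a, a \in t -> m a) ->
  m_primary m (adds Ann (z ++ t)) -> sop m (sub_gen (@zero_sub R M) t) z.
Proof.
move=> [chain _] mz mt prim; have sK := sub_gen_submodule t (@zero_submodule R M).
have sub : subI (adds Ann (z ++ t)) (adds (ann_quot (sub_gen (@zero_sub R M) t)) z).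
  move=> a [Aa|]; first by left=> v; apply: sub_gen_sub.
  by rewrite mem_cat => /orP[|at_]; [right | left=> v; apply: sub_gen_mem].
split=> [|j lt|].
- split.
    apply: (@prime_chain_sub _ (adds Ann t)); last exact: (chain_cuts noeR locR mt chain).
    by move=> P; apply: prime_ann_quot.
  apply: (m_primary_no_chain noeR locR mz); exact: m_primary_sub prim.
- by apply: mz; apply: mem_nth.
- apply: m_primary_finite_length; first exact: sub_gen_submodule.
  apply: m_primary_sub prim => a /sub [Aa|az] v; last exact: sub_gen_mem.
  by apply: sub_gen_sub; apply: Aa.
Qed.

(** [rcons z a] is a system of parameters of [M / t M]; the defining condition of [bideal] is used
    at its last term. *)
Lemma bideal_kill t z a b v : module_dim (@zero_sub R M) (size z + size t).+1 ->
  (forall c, c \in z -> m c) -> (forall c, c \in t -> m c) -> m a ->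
  m_primary m (adds Ann (a :: z ++ t)) ->
  bideal m (sub_gen (@zero_sub R M) t) b ->
  sub_gen (sub_gen (@zero_sub R M) t) z (a *: v) ->
  sub_gen (sub_gen (@zero_sub R M) t) z (b *: v).
Proof.
move=> dimM mz mt ma prim Bb.
have sp : sop m (sub_gen (@zero_sub R M) t) (rcons z a).
  apply: sop_quotient => //; first by rewrite size_rcons addSn.
    by move=> c; rewrite mem_rcons inE => /orP[/eqP->|/mz].
  apply: m_primary_sub prim => c [Ac|]; [by left | right].
  by rewrite mem_cat mem_rcons -mem_cat.
have := Bb _ sp (size z); rewrite size_rcons leqnn => /(_ isT v).
by rewrite nth_rcons ltnn eqxx -cats1 take_size_cat.
Qed.

Lemma m_primary_mul a z : m_primary m (adds Ann (a :: z)) ->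
  m_primary m (adds Ann (a * a :: z)).
Proof.
move=> prim P pP AP; apply: prim => // b [Ab|]; first by apply: AP; left.
rewrite inE => /orP[/eqP->|bz]; last by apply: AP; right; rewrite inE bz orbT.
by apply: (@prime_X _ _ _ 2 pP); apply: AP; right; exact: mem_head.
Qed.

(** A proper [B] lies in [m], so its cube lies in [m B]; if [B] is the unit ideal, [m B] is [m]. *)
Lemma ideal_cube_mprod (B : R -> Prop) a : ideal B -> m a -> ideal_cube B a -> mprod m B a.
Proof.
move=> iB ma cube J iJ sJ; have [_ _ BZ] := iB.
have [B1|B1] := classic (B 1); first by apply: sJ; exists a, 1; rewrite mulr1.
have Bm : subI B m.
  move=> b Bb; apply: NNPP => /(local_unit noeR locR) [t tb]; apply: B1.
  by rewrite -tb; apply: BZ.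
apply: cube => // _ [b [c [e [Bb Bc Be ->]]]]; apply: sJ; exists (b * c), e; split=> //.
by apply: Bm; apply: BZ.
Qed.

(** * Exchange between C-systems of parameters *)

Section CSop.
Variables (d : nat) (dimM : module_dim (@zero_sub R M) d).

Definition bstep (x : seq R) j : R -> Prop :=
  bideal m (sub_gen (@zero_sub R M) (drop j.+1 x)).

Let bstep_ideal x j : ideal (bstep x j).
Proof. by apply: bideal_ideal; apply: sub_gen_submodule; apply: zero_submodule. Qed.

(* The first [i] terms of [x] can be replaced by [z] without changing the socle
   dimension, and [bstep x j + (z)] has dimension at most [j - i] for [i <= j]. *)
Definition exchanged (x : seq R) i z : Prop :=
  [/\ forall j, (i <= j < d)%N -> ~ prime_chain (adds (bstep x j) z) (j - i).+1,
      m_primary m (adds Ann (z ++ drop i x)) &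
      forall n, @ir_is R M m x n <-> @ir_is R M m (z ++ drop i x) n].

(** [b_j] contains the annihilator of [M], [x_j] and all later terms, so adding [x_0, ..., x_(j-1)]
    to it gives an m-primary ideal. *)
Lemma exchanged0 x : @c_sop R M m x -> size x = d -> exchanged x 0 [::].
Proof.
move=> [[_ mx fl] cx] szx.
have prim := finite_length_m_primary fl.
split=> [j /andP[_ lt]||n]; rewrite ?drop0 //.
(* [j] is rewritten as the size of [take j x], the sequence added to [b_j]. *)
rewrite subn0 -[in j.+1](size_takel (ltnW _) : size (take j x) = j) ?szx //.
apply: (m_primary_no_chain noeR locR).
  by move=> a /mem_take /(nthP 0)[k ltk <-]; apply: mx.
apply: m_primary_sub prim => a [Aa|].
  left; left; apply: ann_quot_bideal => v; apply: sub_gen_sub; exact: Aa.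
rewrite -{1}(cat_take_drop j x) mem_cat => /orP[|]; first by right.
rewrite (drop_nth 0) ?szx // inE => /orP[/eqP->|ad]; left; left.
  have ltx : (j < size x)%N by rewrite szx.
  have [_ _ BZ] := bstep_ideal x j.
  by apply: (cx j ltx); [exact: bstep_ideal | move=> _ [b [c [e [_ _ Be ->]]]]; apply: BZ].
by apply: ann_quot_bideal => v; apply: sub_gen_mem.
Qed.

(** Modulo [z] and the terms of [x] after [x_i], both [x_i] and [u] are [swappable] for [b_i], so
    [socle_swap] replaces one by the other. *)
Lemma exchangedS x i z u : @c_sop R M m x -> size x = d -> size z = i -> (i < d)%N ->
  (forall a, a \in z -> m a) -> exchanged x i z -> mprod m (bstep x i) u ->
  (forall j, (i < j < d)%N ->
     ~ prime_chain (adds (adds (bstep x j) z) [:: u]) (j - i)) ->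
  ~ prime_chain (adds (adds Ann (z ++ drop i.+1 x)) [:: u]) 1 ->
  exchanged x i.+1 (rcons z u).
Proof.
move=> [[_ mx _] cx] szx szz ltid mz [_ prim irx] Bu chains /(no_chain_m_primary noeR locR) primu.
have ltix : (i < size x)%N by rewrite szx.
have dropx : drop i x = x`_i :: drop i.+1 x by apply: drop_nth.
have mt : forall a, a \in drop i.+1 x -> m a.
  by move=> a /mem_drop /(nthP 0)[k ltk <-]; apply: mx.
have mu : m u := mprod_local noeR locR Bu.
have [im _ _] := pm; have [_ _ mZ] := im.
have {}primu : m_primary m (adds Ann (u :: z ++ drop i.+1 x)).
  apply: m_primary_sub primu => a [[Aa|az]|au]; first by left.
    by right; rewrite inE az orbT.
  by right; move: au; rewrite !inE => ->.
have primx : m_primary m (adds Ann (x`_i :: z ++ drop i.+1 x)).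
  apply: m_primary_sub prim => a [Aa|az]; first by left.
  by right; move: az; rewrite dropx !(inE, mem_cat) orbCA.
have dimM' : module_dim (@zero_sub R M) (size z + size (drop i.+1 x)).+1.
  by rewrite size_drop szx szz -addnS -subSn // subSS subnKC // ltnW.
have swap_ok a : mprod m (bstep x i) a -> m a ->
    m_primary m (adds Ann (a :: z ++ drop i.+1 x)) ->
    swappable m (sub_gen (sub_gen (@zero_sub R M) (drop i.+1 x)) z) (bstep x i) a.
  (* The square of a parameter is again a parameter, so [bideal_kill] applies to [a * a]. *)
  move=> Ba ma prima; split=> // v Kv b Bb; apply: bideal_kill Kv => //; first exact: mZ.
  exact: m_primary_mul.
have sx := swap_ok _ (ideal_cube_mprod (bstep_ideal x i) (mx _ ltix) (cx _ ltix)) (mx _ ltix) primx.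
have su := swap_ok u Bu mu primu.
have sK : submodule (sub_gen (sub_gen (@zero_sub R M) (drop i.+1 x)) z).
  by do 2!apply: sub_gen_submodule; apply: zero_submodule.
split=> [j /andP[lt1 lt2]||n].
- rewrite -subSn // subSS => /prime_chain_sub h; apply: (chains j); first by rewrite lt1.
  apply: h => P _ AP a [[Aa|az]|au]; apply: AP; [by left | |].
    by right; rewrite mem_rcons inE az orbT.
  by right; rewrite mem_rcons inE; move: au; rewrite inE => ->.
- apply: m_primary_sub primu => a [Aa|]; first by left.
  by right; rewrite mem_cat mem_rcons -mem_cat.
rewrite irx.
have ex v : sub_gen (@zero_sub R M) (z ++ drop i x) v <->
    add_smul (sub_gen (sub_gen (@zero_sub R M) (drop i.+1 x)) z) x`_i v.
  apply: sub_gen_add_smul; first exact: zero_submodule.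
  by move=> a; rewrite dropx !(inE, mem_cat) orbCA.
have eu v : sub_gen (@zero_sub R M) (rcons z u ++ drop i.+1 x) v <->
    add_smul (sub_gen (sub_gen (@zero_sub R M) (drop i.+1 x)) z) u v.
  apply: sub_gen_add_smul; first exact: zero_submodule.
  by move=> a; rewrite mem_cat mem_rcons -mem_cat.
rewrite /ir_is (socle_kdim_eq m n ex) (socle_kdim_eq m n eu).
by split; apply: (socle_swap noeR locR accM sK (bstep_ideal x i)).
Qed.

(** The next term [u] is taken in [m b_i] for both sequences, outside the primes that would prevent
    the dimensions in [exchangedS] from dropping. *)
Lemma common_exchange x y i : @c_sop R M m x -> size x = d -> @c_sop R M m y -> size y = d ->
  (i <= d)%N -> exists z, [/\ size z = i, (forall a, a \in z -> m a),
    exchanged x i z & exchanged y i z].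
Proof.
move=> cx szx cy szy; elim: i => [|i IH] lti.
  by exists [::]; split=> //; apply: exchanged0.
have [z [szz mz ex ey]] := IH (ltnW lti).
pose J a := mprod m (bstep x i) a /\ mprod m (bstep y i) a.
(* After this step [b_i] is under no condition, so the slot [j = i] is given to the ideal of
   dimension at most 1 that [u] has to make m-primary. *)
pose A (k : bool * nat) := let w := if k.1 then x else y in
  if k.2 == i then adds Ann (z ++ drop i.+1 w) else adds (bstep w k.2) z.
have prod_ideal B : ideal (mprod m B) by exact: gen_ideal_ideal.
have iJ : ideal J.
  have [x0 xA xZ] := prod_ideal (bstep x i); have [y0 yA yZ] := prod_ideal (bstep y i).
  by split=> // [a b [xa ya] [xb yb]|r a [xa ya]]; split; auto.
have [|u [[Jx Jy] Hu]] := @parameter_avoidance _ noeR m locR _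
    [seq (b, j) | b <- [:: true; false], j <- iota i (d - i)] A J iJ.
  move=> k _ P pP AP mP JP.
  have zP a : a \in z -> P a.
    by move=> az; apply: AP; rewrite /A; case: ifP => _; right; rewrite ?mem_cat ?az.
  (* The quotient by [b_i + (z)] has dimension at most 0, so a prime that contains [z] but not [m]
     cannot contain [b_i]. *)
  have avoid w : exchanged w i z -> exists b, bstep w i b /\ ~ P b.
    move=> [/(_ i) chain _ _]; apply: not_subset => BP; apply: mP.
    move: chain; rewrite leqnn lti subnn => /(_ isT) /(no_chain_m_primary noeR locR).
    by apply=> // a [/BP|/zP].
  have [b [xb Pb]] := avoid _ ex; have [c [yc Pc]] := avoid _ ey.
  have [r [mr Pr]] := not_subset mP.
  have : P (r * b * c).
    have [_ _ xZ] := prod_ideal (bstep x i); have [_ _ yZ] := prod_ideal (bstep y i).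
    apply: JP; split.
      by rewrite mulrC; apply: xZ => K _; apply; exists r, b.
    by rewrite mulrAC mulrC; apply: yZ => K _; apply; exists r, c.
  by do 2!apply: prime_mul_notin => //.
have mem b j : (i <= j < d)%N ->
    (b, j) \in [seq (b, j) | b <- [:: true; false], j <- iota i (d - i)].
  move=> ltj; apply: allpairs_f; first by case: b.
  by rewrite mem_iota subnKC // ltnW.
have memi b : (b, i) \in [seq (b, j) | b <- [:: true; false], j <- iota i (d - i)].
  by apply: mem; rewrite leqnn.
have mu : m u := mprod_local noeR locR Jx.
have step w b : (if b then x else y) = w -> @c_sop R M m w -> size w = d ->
    exchanged w i z -> mprod m (bstep w i) u -> exchanged w i.+1 (rcons z u).
  move=> ew cw szw [chw primw irw] Bu; apply: exchangedS => // [j /andP[lt1 lt2]|].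
    have := Hu (b, j); rewrite /A /= ew gtn_eqF //; apply.
    - by apply: mem; rewrite ltnW.
    - by rewrite subn_gt0.
    - by apply: chw; rewrite ltnW.
  have := Hu (b, i) (memi b) 1%N isT; rewrite /A /= ew eqxx; apply.
  (* The dimension is at most 1 because restoring the single term [w_i] gives an m-primary ideal. *)
  apply: (m_primary_no_chain noeR locR (z := [:: w`_i])) => [a|].
    by rewrite inE => /eqP->; case: cw => -[_ + _] _; apply; rewrite szw.
  apply: m_primary_sub primw => a [Aa|]; first by left; left.
  rewrite (drop_nth 0) ?szw // mem_cat inE => /or3P[az|aw|ad].
  - by left; right; rewrite mem_cat az.
  - by right; rewrite inE.
  - by left; right; rewrite mem_cat ad orbT.
exists (rcons z u); split.
- by rewrite size_rcons szz.
- by move=> a; rewrite mem_rcons inE => /orP[/eqP->|/mz].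
- exact: (step x true).
- exact: (step y false).
Qed.

End CSop.
End Sop.

Lemma chain_dim_unique (R : comNzRingType) (A : R -> Prop) d e :
  chain_dim A d -> chain_dim A e -> d = e.
Proof.
move=> [cd nd] [ce ne]; have [lt|lt|//] := ltngtP d e.
  by case: nd; apply: prime_chain_leq ce.
by case: ne; apply: prime_chain_leq cd.
Qed.

Theorem theorem3p2 (R : comNzRingType) (m : R -> Prop) (M : lmodType R)
  (d : nat) (x y : seq R) :
  noetherian R -> local_ring m -> cm_image R ->
  fin_gen M -> module_dim (@zero_sub R M) d -> (0 < d)%N ->
  @c_sop R M m x -> @c_sop R M m y ->
  forall n : nat, @ir_is R M m x n <-> @ir_is R M m y n.
Proof.
move=> noeR locR _ fgM dimM _ cx cy n.
have szx : size x = d by case: (cx) => -[dimx _ _] _; apply: chain_dim_unique dimM.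
have szy : size y = d by case: (cy) => -[dimy _ _] _; apply: chain_dim_unique dimM.
(* At [i = d] no term of [x] or [y] remains, and both socle dimensions are that of [z]. *)
have [z [_ _ [_ _ irx] [_ _ iry]]] :=
  common_exchange noeR locR fgM dimM cx szx cy szy (leqnn d).
by rewrite irx iry !drop_oversize ?szx ?szy.
Qed.
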